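(* For any infinite regular ($T_1$) space $X$, the following are equivalent. (i) $X$ is $\omega$-Rothberger. (ii) $X^{<\omega}$ is Rothberger, where $X^{<\omega}$ is the disjoint union of $X^n$ for all $n \geq 1$. (iii) $\mathcal{P}_{\mathrm{fin}}(X)$ is Rothberger, where $\mathcal{P}_{\mathrm{fin}}(X)$ is the set $[X]^{<\omega}$ of non-empty finite subsets of $X$ with the subspace topology inherited from $\mathbb K(X)$. (iv) $\mathrm{I} \not\uparrow \mathsf G_1(\Omega_X , \Omega_X)$. (v) $MU_p(X)$ has strong countable fan-tightness at $\mathbf 0$. (vi) $MU_p(X)$ has strong countable dense fan-tightness at $\mathbf 0$. (vii) $\mathrm{II} \underset{\mathrm{mark}}{\not\uparrow} \mathsf G_1(\mathscr N_X[[X]^{<\omega}], \neg \Omega_X)$. (viii) $\mathrm{II} \not\uparrow \mathsf G_1(\mathscr N_X[[X]^{<\omega}], \neg \Omega_X)$. (ix) $\mathrm{II} \underset{\mathrm{mark}}{\not\uparrow} \mathsf G_1(\mathscr T_{MU_p(X)}, \mathrm{CD}_{MU_p(X)})$. (x) $\mathrm{II} \not\uparrow \mathsf G_1(\mathscr T_{MU_p(X)}, \mathrm{CD}_{MU_p(X)})$. (xi) $\mathrm{II} \underset{\mathrm{mark}}{\not\uparrow} \mathsf G_1(\mathscr N_{MU_p(X),\mathbf 0}, \neg \Omega_{MU_p(X),\mathbf 0})$. (xii) $\mathrm{II} \not\uparrow \mathsf G_1(\mathscr N_{MU_p(X),\mathbf 0}, \neg \Omega_{MU_p(X),\mathbf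 0})$. Also, for any non-compact regular ($T_1$) space $X$, the following are equivalent. (i) $X$ is $k$-Rothberger. (ii) $\mathrm{I} \not\uparrow \mathsf G_1(\mathcal K_X , \mathcal K_X)$. (iii) $MU_k(X)$ has strong countable fan-tightness at $\mathbf 0$. (iv) $MU_k(X)$ has strong countable dense fan-tightness at $\mathbf 0$. (v) $\mathrm{II} \underset{\mathrm{mark}}{\not\uparrow} \mathsf G_1(\mathscr N_X[K(X)], \neg \mathcal K_X)$. (vi) $\mathrm{II} \not\uparrow \mathsf G_1(\mathscr N_X[K(X)], \neg \mathcal K_X)$. (vii) $\mathrm{II} \underset{\mathrm{mark}}{\not\uparrow} \mathsf G_1(\mathscr T_{MU_k(X)}, \mathrm{CD}_{MU_k(X)})$. (viii) $\mathrm{II} \not\uparrow \mathsf G_1(\mathscr T_{MU_k(X)}, \mathrm{CD}_{MU_k(X)})$. (ix) $\mathrm{II} \underset{\mathrm{mark}}{\not\uparrow} \mathsf G_1(\mathscr N_{MU_k(X),\mathbf 0}, \neg \Omega_{MU_k(X),\mathbf 0})$. (x) $\mathrm{II} \not\uparrow \mathsf G_1(\mathscr N_{MU_k(X),\mathbf 0}, \neg \Omega_{MU_k(X),\mathbf 0})$.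
   Context: Games. For collections $\mathcal P,\mathcal Q$ of sets, in the game $\mathsf G_1(\mathcal P,\mathcal Q)$, at round $n\in\omega$ One chooses $P_n\in\mathcal P$ and Two responds with $x_n\in P_n$; Two wins if $\{x_n:n\in\omega\}\in\mathcal Q$, otherwise One wins. $\neg\mathcal Q$ denotes the collection of sets not in $\mathcal Q$. A strategy for One is $\sigma:(\bigcup\mathcal P)^{<\omega}\to\mathcal P$; it is winning if $\{x_n:n\in\omega\}\notin\mathcal Q$ whenever $x_n\in\sigma\langle x_k:k<n\rangle$ for all $n$; $\mathrm I\uparrow$ means One has a winning strategy. A strategy for Two is $\tau:\mathcal P^{<\omega}\to\bigcup\mathcal P$ (giving legal moves); it is winning if $\{\tau(P_0,\dots,P_n):n\in\omega\}\in\mathcal Q$ for all $(P_n)\in\mathcal P^\omega$; $\mathrm{II}\uparrow$ means Two has a winning strategy. A Markov strategy for Two is a function $\mathcal P\times\omega\to\bigcup\mathcal P$ (depends only on One's latest move and the round); $\mathrm{II}\underset{\mathrm{mark}}{\uparrow}$ means Two has a winning one. The selection principle $\mathsf S_1(\mathcal P,\mathcal Q)$ says: for every $(P_n)\in\mathcal P^\omega$ there are $x_n\in P_n$ with $\{x_n:n\in\omega\}\in\mathcal Q$. Classes. $K(X)$ is the set of non-empty compact subsets of $X$; $\mathbb K(X)$ is $K(X)$ with the Vietoris topology; $[X]^{<\omega}$ is the set of (non-empty) finite subsets of $X$. An open cover is non-trivial if neither $\emptyset$ nor the whole space belongs to it. $\mathcal O_X$ is the set of non-trivial open covers of $X$.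 $\Omega_X$ (resp. $\mathcal K_X$) is the set of non-trivial open covers $\mathscr U$ such that each non-empty finite (resp. compact) subset of $X$ is contained in some $U\in\mathscr U$. For a space $Z$: $\mathscr T_Z$ is the family of proper non-empty open subsets of $Z$; $\mathscr N_{Z,z}=\{U\in\mathscr T_Z:z\in U\}$; $\mathscr N_Z(A)=\{U\in\mathscr T_Z:A\subseteq U\}$; $\mathscr N_Z[\mathcal A]=\{\mathscr N_Z(A):A\in\mathcal A\}$; $\mathscr D_Z$ is the set of dense subsets of $Z$; $\Omega_{Z,z}=\{S\subseteq Z: z\in\mathrm{cl}(S)\}$; $\mathrm{CD}_Z$ is the set of closed discrete subsets of $Z$. Named principles. $X$ is Rothberger if $\mathsf S_1(\mathcal O_X,\mathcal O_X)$; $\omega$-Rothberger if $\mathsf S_1(\Omega_X,\Omega_X)$; $k$-Rothberger if $\mathsf S_1(\mathcal K_X,\mathcal K_X)$. $Z$ has strong countable fan-tightness at $z$ if $\mathsf S_1(\Omega_{Z,z},\Omega_{Z,z})$, and strong countable dense fan-tightness at $z$ if $\mathsf S_1(\mathscr D_Z,\Omega_{Z,z})$. Minimal usco maps. An usco map $\Phi$ from $X$ to $\mathbb R$ assigns to each $x\in X$ a non-empty compact set $\Phi(x)\subseteq\mathbb R$ so that $\{x:\Phi(x)\subseteq V\}$ is open for every open $V\subseteq\mathbb R$; it is minimal if its graph $\{(x,y):y\in\Phi(x)\}$ is $\subseteq$-minimal among graphs of usco maps from $X$ to $\mathbb R$. $MU(X)$ is the set of minimal usco maps from $X$ to $\mathbb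 R$. For $\Phi\in MU(X)$, $A\subseteq X$, $\varepsilon>0$, $[\Phi;A,\varepsilon]$ is the set of $\Psi\in MU(X)$ such that for all $x\in A$ each point of $\Phi(x)$ is within distance $<\varepsilon$ of some point of $\Psi(x)$ and each point of $\Psi(x)$ is within distance $<\varepsilon$ of some point of $\Phi(x)$. $MU_p(X)$ (resp. $MU_k(X)$) is $MU(X)$ with the topology in which $O$ is open iff for each $\Phi\in O$ there are a non-empty finite (resp. compact) $A\subseteq X$ and $\varepsilon>0$ with $[\Phi;A,\varepsilon]\subseteq O$. $\mathbf 0\in MU(X)$ is the constant map $x\mapsto\{0\}$. *)

(* Defs.v *)
From HB Require Import structures.
From mathcomp Require Import all_boot all_order all_algebra.
From mathcomp Require Import all_classical all_reals all_analysis.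

Set Implicit Arguments.
Unset Strict Implicit.
Unset Printing Implicit Defensive.

Import Order.TTheory GRing.Theory Num.Theory.
Import numFieldNormedType.Exports.
Local Open Scope classical_set_scope.
Local Open Scope ring_scope.

(* Selection games: One plays members of [P : set (set T)], Two answers with
   points of [T]; the payoff class [Q] is also a family of subsets of [T]. *)
Section Games.
Context {T : choiceType}.
Implicit Types P Q : set (set T).

(* The values of [sigma] outside of (\bigcup P)^{<omega} are irrelevant. *)
Definition one_strategy P (sigma : seq T -> set T) : Prop :=
  forall s : seq T, [set` s] `<=` \bigcup_(A in P) A -> P (sigma s).

Definition one_winning Q (sigma : seq T -> set T) : Prop :=
  forall x : nat -> T, (forall n, sigma (mkseq x n) (x n)) -> ~ Q (range x).

Definition one_wins P Q : Prop :=
  exists sigma, one_strategy P sigma /\ one_winning Q sigma.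

(* [tau (rcons s A)] answers One's last move [A], after the moves [s]. *)
Definition two_strategy P (tau : seq (set T) -> T) : Prop :=
  forall (s : seq (set T)) (A : set T),
    [set` s] `<=` P -> P A -> A (tau (rcons s A)).

(* [mkseq B n.+1] is the sequence of One's moves B 0, ..., B n. *)
Definition two_winning P Q (tau : seq (set T) -> T) : Prop :=
  forall B : nat -> set T, (forall n, P (B n)) ->
    Q (range (fun n => tau (mkseq B n.+1))).

Definition two_wins P Q : Prop :=
  exists tau, two_strategy P tau /\ two_winning P Q tau.

Definition markov_strategy P (tau : set T -> nat -> T) : Prop :=
  forall (A : set T) (n : nat), P A -> A (tau A n).

Definition markov_winning P Q (tau : set T -> nat -> T) : Prop :=
  forall B : nat -> set T, (forall n, P (B n)) ->
    Q (range (fun n => tau (B n) n)).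

Definition two_markov_wins P Q : Prop :=
  exists tau, markov_strategy P tau /\ markov_winning P Q tau.

Definition selection1 P Q : Prop :=
  forall B : nat -> set T, (forall n, P (B n)) ->
    exists x : nat -> T, (forall n, B n (x n)) /\ Q (range x).

End Games.

Section Classes.
Context (Z : topologicalType).

Definition fin_sets : set (set Z) := [set A | finite_set A /\ A !=set0].

Definition compact_sets : set (set Z) := [set A | compact A /\ A !=set0].

Definition open_covers : set (set (set Z)) :=
  [set U | [/\ U `<=` open, \bigcup_(V in U) V = setT, ~ U set0 & ~ U setT]].

Definition covers_of (F : set (set Z)) : set (set (set Z)) :=
  [set U | open_covers U /\ forall A, F A -> exists2 V, U V & A `<=` V].

Definition omega_covers : set (set (set Z)) := covers_of fin_sets.

Definition k_covers : set (set (set Z)) := covers_of compact_sets.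

Definition proper_opens : set (set Z) :=
  [set U | [/\ open U, U !=set0 & U <> setT]].

Definition point_nbhds (z : Z) : set (set Z) :=
  [set U | proper_opens U /\ U z].

Definition set_nbhds (A : set Z) : set (set Z) :=
  [set U | proper_opens U /\ A `<=` U].

Definition family_nbhds (F : set (set Z)) : set (set (set Z)) :=
  [set set_nbhds A | A in F].

Definition dense_sets : set (set Z) := [set S | dense S].

Definition clustering_at (z : Z) : set (set Z) := [set S | closure S z].

Definition closed_discrete : set (set Z) :=
  [set D | closed D /\ D `<=` isolated D].

Definition Rothberger : Prop := selection1 open_covers open_covers.

Definition omega_Rothberger : Prop := selection1 omega_covers omega_covers.

Definition k_Rothberger : Prop := selection1 k_covers k_covers.

Definition strong_countable_fan_tightness (z : Z) : Prop :=
  selection1 (clustering_at z) (clustering_at z).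

Definition strong_countable_dense_fan_tightness (z : Z) : Prop :=
  selection1 dense_sets (clustering_at z).

End Classes.

Arguments fin_sets : clear implicits.
Arguments compact_sets : clear implicits.
Arguments open_covers : clear implicits.
Arguments omega_covers : clear implicits.
Arguments k_covers : clear implicits.
Arguments proper_opens : clear implicits.
Arguments dense_sets : clear implicits.
Arguments closed_discrete : clear implicits.

(* The disjoint union of the powers X^(n+1), n : nat, each with the product
   topology. *)
Definition finite_powers (X : topologicalType) : topologicalType :=
  {n : nat & {ptws 'I_n.+1 -> X}}.

Section Hyperspace.
Context (X : topologicalType).

Definition hyperspace : Type := set_type (compact_sets X).

HB.instance Definition _ :=
  Choice.copy hyperspace (set_type (compact_sets X)).

(* The Vietoris topology. *)
Definition vietoris_subbase : set (set hyperspace) :=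
  [set W | exists2 U : set X, open U &
     W = [set K : hyperspace | set_val K `<=` U] \/
     W = [set K : hyperspace | set_val K `&` U !=set0]].

HB.instance Definition _ :=
  @isSubBaseTopological.Build hyperspace _ vietoris_subbase id.

(* [set_type] carries the subspace topology inherited from [hyperspace X]. *)
Definition Pfin : topologicalType :=
  set_type [set K : hyperspace | finite_set (set_val K)].

End Hyperspace.

(* The base point of [X] only records that [X] is nonempty: over the empty
   space [MU_open] below would not contain the whole of [MU]. *)
Section MinimalUsco.
Context (X : ptopologicalType) (R : realType).

Definition usco (Phi : X -> set R) : Prop :=
  [/\ forall x, Phi x !=set0,
      forall x, compact (Phi x) &
      forall V : set R, open V -> open [set x | Phi x `<=` V]].

Definition usco_graph (Phi : X -> set R) : set (X * R) :=
  [set p | Phi p.1 p.2].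

Definition minimal_usco (Phi : X -> set R) : Prop :=
  usco Phi /\ forall Psi, usco Psi -> usco_graph Psi `<=` usco_graph Phi ->
    usco_graph Psi = usco_graph Phi.

Record MU : Type := MkMU {
  MU_fun :> X -> set R;
  MU_minimal : minimal_usco MU_fun }.

HB.instance Definition _ := gen_eqMixin MU.
HB.instance Definition _ := gen_choiceMixin MU.

Definition MU_ball (Phi : MU) (A : set X) (e : R) : set MU :=
  [set Psi : MU | forall x, A x ->
     (forall y, Phi x y -> exists2 z, Psi x z & `|y - z| < e) /\
     (forall z, Psi x z -> exists2 y, Phi x y & `|y - z| < e)].

Definition MU_open (F : set (set X)) (O : set MU) : Prop :=
  forall Phi, O Phi ->
    exists A (e : R), [/\ F A, 0 < e & MU_ball Phi A e `<=` O].

Lemma MU_ballS (Phi : MU) (A B : set X) (d e : R) :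
  A `<=` B -> d <= e -> MU_ball Phi B d `<=` MU_ball Phi A e.
Proof.
move=> AB de Psi h x /AB /h[h1 h2]; split=> y.
- by move=> /h1[z Pz yz]; exists z => //; apply: lt_le_trans de.
- by move=> /h2[z Pz yz]; exists z => //; apply: lt_le_trans de.
Qed.

Section Open.
Context (F : set (set X)) (F0 : F !=set0) (FU : setU_closed F).

Lemma MU_openT : MU_open F setT.
Proof. by case: F0 => A FA Phi _; exists A, 1; split. Qed.

Lemma MU_openI : setI_closed (MU_open F).
Proof.
move=> O P oO oP Phi [/oO[A [d [FA d0 AO]]] /oP[B [e [FB e0 BP]]]].
exists (A `|` B), (Num.min d e); split; first exact: FU.
  by rewrite lt_min d0.
move=> Psi h; split.
- by apply: AO; apply: MU_ballS h => //; rewrite ge_min lexx.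
- by apply: BP; apply: MU_ballS h => //; rewrite ge_min lexx orbT.
Qed.

Lemma MU_open_bigU (I : Type) (f : I -> set MU) :
  (forall i, MU_open F (f i)) -> MU_open F (\bigcup_i f i).
Proof.
move=> of_ Phi [i _ /of_[A [e [FA e0 AO]]]].
by exists A, e; split=> // Psi /AO fi; exists i.
Qed.

End Open.

Lemma fin_sets_neq0 : fin_sets X !=set0.
Proof. by exists [set point]; split; [exact: finite_set1|exists point]. Qed.

Lemma fin_setsU : setU_closed (fin_sets X).
Proof.
move=> A B [fA [a Aa]] [fB _]; split; last by exists a; left.
by rewrite finite_setU.
Qed.

Lemma compact_sets_neq0 : compact_sets X !=set0.
Proof. by exists [set point]; split; [exact: compact_set1|exists point]. Qed.

Lemma compact_setsU : setU_closed (compact_sets X).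
Proof.
move=> A B [fA [a Aa]] [fB _]; split; last by exists a; left.
exact: compactU.
Qed.

(* [MUp] and [MUk] are copies of [MU] with the topologies of uniform
   convergence, for the Hausdorff distance of values, on the nonempty finite,
   resp. compact, subsets of [X]. *)
Definition MUp : Type := MU.
HB.instance Definition _ := Choice.copy MUp MU.
HB.instance Definition _ := @isOpenTopological.Build MUp
  (MU_open (fin_sets X)) (MU_openT fin_sets_neq0) (MU_openI fin_setsU)
  (@MU_open_bigU (fin_sets X)).

Definition MUk : Type := MU.
HB.instance Definition _ := Choice.copy MUk MU.
HB.instance Definition _ := @isOpenTopological.Build MUk
  (MU_open (compact_sets X)) (MU_openT compact_sets_neq0)
  (MU_openI compact_setsU) (@MU_open_bigU (compact_sets X)).

Lemma minimal_usco0 : minimal_usco (fun=> [set 0]).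
Proof.
split; first split=> [x|x|V oV].
- by exists 0.
- exact: compact_set1.
- have [V0|V0] := pselect (V 0).
    suff -> : [set x | [set 0] `<=` V] = @setT X by exact: openT.
    by apply/seteqP; split=> // x _ /= _ ->.
  suff -> : [set x | [set 0] `<=` V] = @set0 X by exact: open0.
  by apply/seteqP; split=> // x /= h; apply/V0/h.
- move=> Psi [Psi0 _ _] h; apply/seteqP; split=> // -[x y]; rewrite /usco_graph /= => ->.
  have [z Pz] := Psi0 x.
  by have := h (x, z) Pz; rewrite /usco_graph /= => <-.
Qed.

Definition MU0 : MU := MkMU minimal_usco0.
Definition MUp0 : MUp := MU0.
Definition MUk0 : MUk := MU0.

End MinimalUsco.

(* Main.v *)
Require Import Defs.
From HB Require Import structures.
From mathcomp Require Import all_boot all_order all_algebra.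
From mathcomp Require Import all_classical all_reals all_analysis.
Local Open Scope classical_set_scope.

(** Fix the family [F] of the nonempty finite, or nonempty compact, subsets of
    [X], and view an open cover of the members of [F] as an ordinary cover of
    the space [upper_space F], whose points are the members of [F] and whose
    basic open sets are the families of all members included in a given open
    set of [X].  The selection principle for covers of [F] then says that this
    space is Rothberger, so Pawlikowski's theorem applies to it: if One
    cannot defeat Two by announcing all covers in advance, One cannot defeat Two
    at all.  The theorem is used in the form [covering_runs F]: however One
    moves, some run of the game covers each member of [F] infinitely often.
    Everything is proved by deriving each condition from [covering_runs F] and
    deriving the selection principle from each condition
    ([covering_games_tfae]).

    From runs to games.  A position of the game may record anything, such as
    the moves made in another game.  If Two had a winning strategy in one of the
    dual games, One could play there, for a set [A] in [F], the neighborhoods of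
    [A], or smaller and smaller neighborhoods of the zero map given by [A]; the
    answers of Two are open sets including [A], or maps that are small on an
    open set including [A], and a covering run is a play that Two loses.
    Removing the zero map itself from these neighborhoods turns clustering at
    zero into a failure to be closed, which settles the closed discrete game.

    From games to covers.  A sequence of covers of [F] without good selection
    gives Two a Markov strategy.  In spaces of usco maps this requires, for [A]
    in [F] inside an open set [U], a minimal usco map that agrees with a given
    one on [A] and is a given constant [c] off [U] ([minimal_usco_glue]):
    regularity separates [A] from the complement of [U] by an open set, and
    closing the graph along the boundary of that set yields minimality.  With
    [c] equal to 1 the maps obtained from a cover are dense, and they are near
    zero only when [A] is covered; with [c] equal to the number of the round,
    Two's answers run off to infinity on a set [A] that is never covered, hence
    form a closed discrete set.

    Finite powers.  A finite set has finitely many tuples of a given length, so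
    in one round of a run finitely many covers of the powers of [X] suffice to
    cover the short tuples from a neighborhood of the set; a covering run thus
    yields a selection that covers all powers ([covering_runs_powers]).  The
    space of finite subsets is a continuous image of the sum of the powers, and
    covers of finite sets are covers of that space. *)

Set Implicit Arguments.
Unset Strict Implicit.
Unset Printing Implicit Defensive.

Import Order.TTheory GRing.Theory Num.Theory.
Import numFieldNormedType.Exports.

(** * Rothberger spaces and Pawlikowski's theorem *)

Lemma mkseqSr (T : Type) (f : nat -> T) n :
  mkseq f n.+1 = rcons (mkseq f n) (f n).
Proof. by rewrite /mkseq -addn1 iotaD map_cat cats1. Qed.

Lemma mkseq_cat (T : Type) (f : nat -> T) m n :
  mkseq f m ++ mkseq (fun k => f (m + k)%N) n = mkseq f (m + n).
Proof.
by elim: n => [|n IH]; rewrite ?addn0 ?cats0// addnS !mkseqSr -IH rcons_cat.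
Qed.

Lemma take_mkseq (T : Type) (f : nat -> T) m n : (m <= n)%N ->
  take m (mkseq f n) = mkseq f m.
Proof.
by move=> mn; rewrite -(subnKC mn) -mkseq_cat take_size_cat// size_mkseq.
Qed.

Lemma history_rec (T : Type) (g : seq T -> T) :
  exists f : nat -> T, forall n, f n = g (mkseq f n).
Proof.
pose h n := iter n (fun s => rcons s (g s)) [::].
exists (g \o h) => n /=; congr g.
by elim: n => //= n IH; rewrite {1}IH mkseqSr /= -IH.
Qed.

Lemma history_choice (T : Type) (Q : seq T -> T -> Prop) :
  (forall s, exists x, Q s x) ->
  exists f : nat -> T, forall n, Q (mkseq f n) (f n).
Proof.
move=> /choice[g Qg]; have [f fE] := history_rec g.
by exists f => n; rewrite fE.
Qed.

(** The Rothberger property without the nontriviality requirement on covers, so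
    that covers may be refined, intersected and so on freely. *)
Definition plain_Rothberger (Y : topologicalType) : Prop :=
  forall C : nat -> set (set Y), (forall n, C n `<=` open) ->
    (forall n y, exists2 O, C n O & O y) ->
  exists O : nat -> set Y, (forall n, C n (O n)) /\ forall y, exists n, O n y.

Section Pawlikowski.
Context (Y : topologicalType) (RY : plain_Rothberger Y).

Lemma indexed_Rothberger (I : Type) (U : nat -> I -> set Y) :
  (forall n i, open (U n i)) -> (forall n y, exists i, U n i y) ->
  exists i : nat -> I, forall y, exists n, U n (i n) y.
Proof.
move=> oU covU.
have [n _ [i _ <-]|n y|O [CO covO]] := RY (C := fun n => range (U n)).
- exact: oU.
- by have [i Ui] := covU n y; exists (U n i) => //; exists i.
have /choice[i iO] : forall n, exists i, U n i = O n.
  by move=> n; have [i _ iO] := CO n; exists i.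
by exists i => y; have [n Oy] := covO y; exists n; rewrite iO.
Qed.

Lemma open_all_seq (I : eqType) (L : seq I) (U : I -> set Y) :
  (forall i, open (U i)) -> open [set y | forall i, i \in L -> U i y].
Proof.
move=> oU; elim: L => [|i L IH].
  rewrite (_ : mkset _ = setT); first exact: openT.
  by apply/seteqP; split.
rewrite (_ : mkset _ = U i `&` [set y | forall j, j \in L -> U j y]).
  exact: openI.
apply/seteqP; split=> [y Uy|y [Uiy Uy] j].
  by split=> [|j jL]; apply: Uy; rewrite inE ?eqxx ?jL ?orbT.
by rewrite inE => /orP[/eqP ->//|]; exact: Uy.
Qed.

(** Families that catch each point infinitely often are as good as covers: the
    [k]-th auxiliary cover consists of intersections taken over [k.+1] distinct
    rounds, and among those one can pick a round that the previous [k] choices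
    have left free. *)
Lemma Rothberger_infinitely_often (I : Type) (W : nat -> I -> set Y) :
  (forall n i, open (W n i)) ->
  (forall y N, exists2 n, (N <= n)%N & exists i, W n i y) ->
  exists i : nat -> I, forall y, exists n, W n (i n) y.
Proof.
move=> oW covW.
pose J := (seq nat * (nat -> I))%type.
pose V k : set (set Y) := [set O | exists2 p : J,
  uniq p.1 /\ size p.1 = k.+1 &
  O = [set y | forall n, n \in p.1 -> W n (p.2 n) y]].
have [k _ [[s q] _ ->]|k y|O [VO covO]] := RY (C := V).
- by apply: open_all_seq => n; exact: oW.
- have /choice[f fP] : forall N, exists n, (N <= n)%N /\ exists i, W n i y.
    by move=> N; have [n Nn Wn] := covW y N; exists n.
  have [_ [i0 _]] := fP 0%N.
  have /choice[q qP] : forall n, exists i, (exists i, W n i y) -> W n i y.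
    move=> n; have [[i Wi]|nW] := pselect (exists i, W n i y).
      by exists i.
    by exists i0 => /nW.
  pose g j := iter j (fun m => f m.+1) (f 0%N).
  exists [set z | forall n, n \in mkseq g k.+1 -> W n (q n) z].
    exists (mkseq g k.+1, q) => //; split; last exact: size_mkseq.
    have incr a b : (a < b)%N -> (g a < g b)%N.
      elim: b => // b IH; rewrite ltnS leq_eqVlt => /orP[/eqP ->|/IH lt].
        by have [] := fP (g b).+1.
      by apply: ltn_trans lt _; have [] := fP (g b).+1.
    rewrite /fst map_inj_uniq ?iota_uniq// => a b.
    by case: (ltngtP a b) => // /incr + eab; rewrite eab ltnn.
  move=> n /mapP[j _ ->]; apply: qP.
  by case: j => [|j]; [have [] := fP 0%N|have [] := fP (g j).+1].
have /choice[p pP] : forall k, exists p : J,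
    (uniq p.1 /\ size p.1 = k.+1) /\
    O k = [set y | forall n, n \in p.1 -> W n (p.2 n) y].
  by move=> k; have [p ? ?] := VO k; exists p.
have [s|f fP] := @history_choice nat
    (fun s n => n \in (p (size s)).1 /\ n \notin s).
  have [[us ss] _] := pP (size s).
  apply: contrapT => h; suff : (size s < size s)%N by rewrite ltnn.
  rewrite -{1}ss; apply: uniq_leq_size => // n np.
  by apply: contrapT => /negP ns; apply: h; exists n.
have f_inj : injective f.
  move=> a b; case: (ltngtP a b) => // ab eab.
    have [_ /negP[]] := fP b; apply/mapP; exists a => //.
    by rewrite mem_iota.
  have [_ /negP[]] := fP a; apply/mapP; exists b => //.
  by rewrite mem_iota.
have /choice[i iP] : forall n, exists i, forall k, f k = n -> i = (p k).2 n.
  move=> n; have [[k fk]|nf] := pselect (exists k, f k = n).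
    by exists ((p k).2 n) => l fl; congr ((p _).2 n); apply: f_inj; rewrite fk.
  by exists ((p 0%N).2 0%N) => k fk; case: nf; exists k.
exists i => y; have [k Oy] := covO y; exists (f k).
rewrite (iP _ k erefl); move: Oy; rewrite (pP k).2; apply.
by have := (fP k).1; rewrite size_mkseq.
Qed.

Section Hurewicz.
Context (G : seq nat -> nat -> set Y).
Context (oG : forall t i, open (G t i)).
Context (homG : forall t i j, (i <= j)%N -> G t i `<=` G t j).
Context (covG : forall t y, exists i, G t i y).

(** [y] lies in [caught n t c] when, starting from the position [t], a run of
    [n.+1] moves with a last move at least [c] is bound to capture [y] at one
    of its rounds.  The recursion keeps the set open: once the first move
    exceeds some [b] it captures [y] by itself, and only finitely many first
    moves remain to be looked at. *)
Fixpoint caught (n : nat) (t : seq nat) (c : nat) : set Y :=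
  if n is m.+1 then
    [set y | exists b, G t b y /\
                       forall a, a \in iota 0 b -> caught m (rcons t a) c y]
  else G t c.

Lemma open_caught n t c : open (caught n t c).
Proof.
elim: n t c => [|n IH] t c /=; first exact: oG.
rewrite (_ : mkset _ = \bigcup_b (G t b `&`
    [set y | forall a, a \in iota 0 b -> caught n (rcons t a) c y])).
  apply: bigcup_open => b _; apply: openI => //.
  by apply: open_all_seq => a; exact: IH.
by apply/seteqP; split=> [y [b ?]|y [b _ ?]]; exists b.
Qed.

Lemma caught_homo n t c d : (c <= d)%N -> caught n t c `<=` caught n t d.
Proof.
move=> cd; elim: n t => [|n IH] t /=; first exact: homG.
by move=> y [b [Gb h]]; exists b; split=> // a /h; exact: IH.
Qed.

Lemma caught_cover n t y : exists c, caught n t c y.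
Proof.
elim: n t => [|n IH] t /=; first exact: covG.
have [b Gb] := covG t y; have /choice[f fP] := fun a => IH (rcons t a).
exists (\max_(a < b) f a); exists b; split=> // a; rewrite mem_iota /= => ab.
by apply: caught_homo (fP a); exact: (leq_bigmax (Ordinal ab)).
Qed.

Lemma caughtP n t c y (m : nat -> nat) : caught n t c y -> (c <= m n)%N ->
  exists j, G (t ++ mkseq m j) (m j) y.
Proof.
elim: n t m => [|n IH] t m /=.
  by move=> Gc cm; exists 0%N; rewrite cats0; apply: homG Gc.
move=> [b [Gb h]] cm; have [bm|mb] := leqP b (m 0%N).
  by exists 0%N; rewrite cats0; apply: homG Gb.
have [|j Gj] := IH _ (m \o succn) (h (m 0%N) _) cm; first by rewrite mem_iota.
by exists j.+1; rewrite /mkseq /= (iotaDl 1 0) -map_comp -cat_rcons.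
Qed.

(** Hurewicz's theorem: in the game where the covers increase, so that a move
    is just an index, a single run captures every point infinitely often.  For
    each position [t] the Menger property, a weak form of Rothberger's, bounds
    the moves that [caught] needs after [t]; a run that keeps above the bounds
    of all positions it has gone through works. *)
Lemma Hurewicz : exists m : nat -> nat, forall y N,
  exists2 n, (N <= n)%N & G (mkseq m n) (m n) y.
Proof.
have /choice[g gP] : forall t, exists g : nat -> nat,
    forall y, exists n, caught n t (g n) y.
  move=> t; apply: (@indexed_Rothberger nat (fun n => caught n t)) => n c.
    exact: open_caught.
  exact: caught_cover.
pose bound (t : seq nat) := \max_(N < (size t).+1) g (take N t) (size t - N)%N.
have [m mE] := history_rec bound.
exists m => y N; have [n cn] := gP (mkseq m N) y.
have [|j Gj] := caughtP (m := fun k => m (N + k)%N) cn.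
  have Nn : (N < (N + n).+1)%N by rewrite ltnS leq_addr.
  rewrite mE /bound size_mkseq.
  have := leq_bigmax (F := fun i : 'I_(N + n).+1 =>
    g (take i (mkseq m (N + n))) (N + n - i)%N) (Ordinal Nn).
  by rewrite /= take_mkseq ?leq_addr// addKn.
by exists (N + j)%N; rewrite ?leq_addr -?mkseq_cat.
Qed.

End Hurewicz.

(** A tree of countable covers has a covering branch.  Hurewicz's theorem
    bounds the branches by a sequence [m] in such a way that, infinitely often,
    each point has indices at most [m n] at all of the finitely many nodes of
    level [n] below [m] at once.  A function guessing these indices thus yields
    an open set for round [n], and the guesses that win in this simultaneous
    selection are then followed along the branch that they define. *)
Lemma covering_branch (U : seq nat -> nat -> set Y) :
  (forall t i, open (U t i)) -> (forall t y, exists i, U t i y) ->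
  exists f : nat -> nat, forall y, exists n, U (mkseq f n) (f n) y.
Proof.
move=> oU covU.
pose level := foldl (fun (L : seq (seq nat)) m =>
  [seq rcons s i | s <- L, i <- iota 0 m.+1]) [:: [::]].
pose G t c := [set y | forall s, s \in level t ->
  exists2 i, (i <= c)%N & U s i y].
have [t i|t i j ij y Gy s /Gy[k ki Uk]|t y|m mP] := @Hurewicz G.
- apply: open_all_seq => s.
  rewrite (_ : (fun _ => _) = \bigcup_(j in [set j | (j <= i)%N]) U s j).
    by apply: bigcup_open => j _.
  by apply/seteqP; split=> [y [j ? ?]|y [j ? ?]]; exists j.
- by exists k => //; exact: leq_trans ij.
- have /choice[f fP] := covU^~ y.
  exists (\max_(s <- level t) f s) => s st; exists (f s) => //.
  by rewrite (big_rem s)//= leq_max leqnn.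
(* The cap [m n] on the guesses keeps the branch inside the levels. *)
pose W n (g : seq nat -> nat) :=
  [set y | forall s, s \in level (mkseq m n) -> U s (minn (g s) (m n)) y].
have [n g|y N|g gP] := @Rothberger_infinitely_often _ W.
- by apply: open_all_seq => s; exact: oU.
- have [n Nn Gn] := mP y N; exists n => //.
  have /choice[q qP] : forall s, exists i, s \in level (mkseq m n) ->
      (i <= m n)%N /\ U s i y.
    move=> s; have [/Gn[i im Ui]|ns] := boolP (s \in level (mkseq m n)).
      by exists i.
    by exists 0%N.
  exists q => s /qP[qm Uq].
  by rewrite (minn_idPl qm).
have [f fE] := history_rec (fun s => minn (g (size s) s) (m (size s))).
have fm n : (f n <= m n)%N by rewrite fE size_mkseq geq_minr.
have flevel n : mkseq f n \in level (mkseq m n).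
  elim: n => [|n IH]; first by rewrite inE.
  rewrite !mkseqSr /level foldl_rcons; apply: allpairs_f => //.
  by rewrite mem_iota /= ltnS.
exists f => y; have [n Wn] := gP y; exists n.
by rewrite fE size_mkseq; exact: Wn.
Qed.

(** Pawlikowski's theorem, with strategies replaced by positions: from a
    position [s], One offers the open sets attached to the positions in
    [next s].  Constant sequences of covers show that One may be assumed to
    offer countable covers, so that runs are branches of a tree. *)
Theorem Pawlikowski (S : Type) (legal : S -> Prop) (next : S -> set S)
    (ans : S -> set Y) (s0 : S) : legal s0 ->
  (forall s s', legal s -> next s s' -> legal s' /\ open (ans s')) ->
  (forall s y, legal s -> exists2 s', next s s' & ans s' y) ->
  exists r : nat -> S, [/\ r 0%N = s0, forall n, next (r n) (r n.+1) &
    forall y, exists n, ans (r n.+1) y].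
Proof.
move=> l0 lnext cov.
have /choice[e eP] : forall s, exists e : nat -> S, legal s ->
    (forall i, next s (e i)) /\ forall y, exists i, ans (e i) y.
  move=> s; have [ls|nls] := pselect (legal s); last first.
    by exists (fun=> s0) => /nls.
  pose O (n : nat) : set (set Y) := [set ans s' | s' in next s].
  have [n _ [s' ss' <-]|n y|V [OV covV]] := RY (C := O).
  - by have [] := lnext _ _ ls ss'.
  - have [s' ss' sy] := cov s y ls; exists (ans s') => //.
    by exists s'.
  have /choice[e eP] : forall n, exists s', next s s' /\ ans s' = V n.
    by move=> n; have [s' ? ?] := OV n; exists s'.
  exists e => _; split=> [i|y]; first by have [] := eP i.
  by have [n Vn] := covV y; exists n; have [_ ->] := eP n.
pose pos := foldl e s0.
have pos_rcons t i : pos (rcons t i) = e (pos t) i by rewrite /pos foldl_rcons.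
have lpos t : legal (pos t).
  elim/last_ind: t => // t i IH; rewrite pos_rcons.
  by have [/(_ i)/(lnext _ _ IH)[]] := eP _ IH.
have [t i|t y|f fP] := @covering_branch (fun t i => ans (pos (rcons t i))).
- by rewrite pos_rcons; have [/(_ i)/(lnext _ _ (lpos t))[]] := eP _ (lpos t).
- have [_ /(_ y)[i Ui]] := eP _ (lpos t); exists i.
  by rewrite pos_rcons.
exists (fun n => pos (mkseq f n)); split=> // [n|y].
- by rewrite mkseqSr pos_rcons; have [] := eP _ (lpos (mkseq f n)).
- by have [n Un] := fP y; exists n; rewrite mkseqSr.
Qed.

End Pawlikowski.

(** * General facts on selection games *)

Section GameFacts.
Context (T : choiceType) (P Q : set (set T)).

Lemma one_wins_selection1 : ~ one_wins P Q -> selection1 P Q.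
Proof.
move=> nI B PB; apply: contrapT => nB; apply: nI.
exists (fun s => B (size s)); split=> [s _|x xB Qx]; first exact: PB.
by apply: nB; exists x; split=> // n; have := xB n; rewrite size_mkseq.
Qed.

Lemma two_markov_wins_two_wins : two_markov_wins P Q -> two_wins P Q.
Proof.
move=> [tau [tauP tauQ]].
exists (fun s => tau (last set0 s) (size s).-1); split=> [s A _ PA|B PB].
  by rewrite last_rcons; exact: tauP.
rewrite (_ : (fun n => _) = fun n => tau (B n) n); first exact: tauQ.
by apply/funext => n; rewrite size_mkseq mkseqSr last_rcons.
Qed.

End GameFacts.

(** * Covers of a family of sets, and the upper topology *)

Section Upper.
Context (X : topologicalType) (F : set (set X)).

Definition upper_space : Type := set_type F.

Definition upper_point A (FA : F A) : upper_space := SigSub (mem_set FA).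

Definition upper_open : set (set upper_space) :=
  [set O | forall A, O A -> exists V, [/\ open V, set_val A `<=` V &
    forall B : upper_space, set_val B `<=` V -> O B]].

Lemma upper_openT : upper_open setT.
Proof. by move=> A _; exists setT; split=> //; exact: openT. Qed.

Lemma upper_openI : setI_closed upper_open.
Proof.
move=> O P oO oP A [/oO[V [oV AV VO]] /oP[W [oW AW WP]]].
exists (V `&` W); split; first exact: openI.
  by move=> x Ax; split; [exact: AV|exact: AW].
by move=> B; rewrite subsetI => -[/VO ? /WP ?].
Qed.

Lemma upper_open_bigU (I : Type) (f : I -> set upper_space) :
  (forall i, upper_open (f i)) -> upper_open (\bigcup_i f i).
Proof.
move=> of_ A [i _ /of_[V [oV AV Vf]]].
by exists V; split=> // B /Vf fB; exists i.
Qed.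

HB.instance Definition _ := Choice.copy upper_space (set_type F).
HB.instance Definition _ := @isOpenTopological.Build upper_space
  upper_open upper_openT upper_openI upper_open_bigU.

End Upper.
Arguments upper_space {X} F.

(** Positions of an arbitrary type stand in for strategies, so that the moves of
    another game can be carried along.  The offers [ans] may be trivial open
    sets, so that the removal of points that makes them proper is done once and for
    all in the proof that covering runs exist. *)
Definition covering_runs (X : topologicalType) (F : set (set X)) : Prop :=
  forall (S : Type) (legal : S -> Prop) (next : S -> set S)
    (ans : S -> set X) (s0 : S), legal s0 ->
  (forall s s', legal s -> next s s' -> legal s') ->
  (forall s A, legal s -> F A ->
    exists s', [/\ next s s', open (ans s') & A `<=` ans s']) ->
  exists r : nat -> S, [/\ r 0%N = s0, forall n, next (r n) (r n.+1) &
    forall A N, F A -> exists2 n, (N <= n)%N & A `<=` ans (r n.+1)].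

Section Covers.
Context (X : topologicalType) (T1_X : accessible_space X) (F : set (set X)).
Context (F1 : forall x, F [set x]) (FU : setU_closed F).
Context (F0 : forall A, F A -> A !=set0) (FT : ~ F setT).

Let Fcovers := covers_of F.

Lemma covers_of_proper (U : set (set X)) : U `<=` proper_opens X ->
  (forall A, F A -> exists2 V, U V & A `<=` V) -> Fcovers U.
Proof.
move=> Up UF; split=> //; split.
- by move=> V /Up[].
- apply/seteqP; split=> // x _; have [V UV xV] := UF _ (F1 x).
  by exists V => //; exact: xV.
- by move=> /Up[_ [x]].
- by move=> /Up[_ _].
Qed.

Lemma covers_ofW (U : set (set X)) : Fcovers U -> U `<=` proper_opens X.
Proof.
move=> [[Uo _ U0 UT] _] V UV; split=> [||VT]; first exact: Uo.
  by apply/set0P/eqP => V0; apply: U0; rewrite -V0.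
by apply: UT; rewrite -VT.
Qed.

Lemma F_notT A : F A -> exists p, ~ A p.
Proof.
move=> FA; apply: contrapT => h; apply: FT.
rewrite (_ : setT = A)//; apply/seteqP; split=> // x _.
by apply: contrapT => nA; apply: h; exists x.
Qed.

(** Nontriviality of covers is harmless because a point off [A] can be removed
    from a neighborhood of [A]. *)
Lemma proper_shrink A V : F A -> open V -> A `<=` V ->
  exists2 W, set_nbhds A W & W `<=` V.
Proof.
move=> FA oV AV; have [p nAp] := F_notT FA.
have AW : A `<=` V `\ p by move=> x Ax; split; [exact: AV|move=> /= xp; subst x].
exists (V `\ p); last by move=> x [].
split=> //; split.
- apply: openI => //; apply: closed_openC.
  exact: accessible_closed_set1.
- by have [x /AW] := F0 FA; exists x.
- by move=> WT; have [_ []] : (V `\ p) p by rewrite WT.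

Qed.

Lemma covers_of_upper_Rothberger :
  selection1 Fcovers Fcovers -> plain_Rothberger (upper_space F).
Proof.
move=> S1 C oC covC.
pose U n := [set V | proper_opens X V /\
  exists2 O, C n O & forall B : upper_space F, set_val B `<=` V -> O B].
have [n|V [UV [_ covV]]] := S1 U.
  apply: covers_of_proper => [V []//|A FA].
  have [G CG GA] := covC n (upper_point FA).
  have [V [oV AV VG]] := oC _ _ CG _ GA.
  have [W [pW AW] WV] := proper_shrink FA oV AV.
  exists W => //; split=> //; exists G => // B BW; apply: VG.
  exact: subset_trans WV.
have /choice[f fP] : forall n, exists O, C n O /\
    forall B : upper_space F, set_val B `<=` V n -> O B.
  by move=> n; have [_ [G CG VG]] := UV n; exists G.
exists f; split=> [n|A]; first by have [] := fP n.
have [_ [n _ <-] AV] := covV _ (set_valP A).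
by exists n; apply (fP n).2.
Qed.

(** Adding to [A] one missed point for each of the first [N] answers forces [A]
    to be covered later than that. *)
Lemma covers_of_covering_runs : selection1 Fcovers Fcovers -> covering_runs F.
Proof.
move=> /covers_of_upper_Rothberger RF S legal next ans s0 l0 lnext cov.
(* The second component of a position is a nontrivial open part of the answer,
   off which a point can be found. *)
have [//|s s' ls [ss' oV]|[s V] A ls|r [r0 rn rcov]] := Pawlikowski RF
    (legal := fun s => legal s.1)
    (next := fun s => [set s' : S * set X | next s.1 s'.1 /\
       [/\ open s'.2, s'.2 <> setT & s'.2 `<=` ans s'.1]])
    (ans := fun s => [set A | set_val A `<=` s.2])
    (s0 := (s0, set0)).
- split; first exact: lnext ss'.
  by move=> A AV; exists s'.2; split=> //; case: oV.
- have [s' [ss' os' As']] := cov s _ ls (set_valP A).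
  have [W [[oW _ WT] AW] Ws'] := proper_shrink (set_valP A) os' As'.
  by exists (s', W).
exists (fst \o r); split=> [|n|A N FA]; first by rewrite /= r0.
  by have [] := rn n.
have /choice[p pP] : forall n, exists p, ~ (r n.+1).2 p.
  move=> n; have [_ [_ VT _]] := rn n; apply: contrapT => h; apply: VT.
  apply/seteqP; split=> // x _.
  by apply: contrapT => nV; apply: h; exists x.
have [B [FB AB pB]] : exists B,
    [/\ F B, A `<=` B & forall n, (n < N)%N -> B (p n)].
  elim: N => [|N [B [FB AB pB]]]; first by exists A; split=> // n; rewrite ltn0.
  exists (B `|` [set p N]); split; first by apply: FU => //; exact: F1.
    by move=> x /AB; left.
  by move=> n; rewrite ltnS leq_eqVlt => /orP[/eqP ->|/pB]; [right|left].
have [n BV] := rcov (upper_point FB).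
exists n; last first.
  have [_ [_ _ Vans]] := rn n.
  by apply: subset_trans Vans; apply: subset_trans BV.
by rewrite leqNgt; apply/negP => /pB /BV; exact: pP.
Qed.

(** Positions are the finite sequences of Two's moves. *)
Lemma covering_runs_one_wins : covering_runs F -> ~ one_wins Fcovers Fcovers.
Proof.
move=> runF [sigma [sigmaP sigmaQ]].
pose legal (s : seq (set X)) := [set` s] `<=` \bigcup_(A in Fcovers) A.
have [//|s _ ls [V sV <-] W|s A ls FA|r [r0 rn rcov]] := runF (seq (set X)) legal
    (fun s => [set rcons s V | V in sigma s]) (last set0) [::].
- rewrite /= mem_rcons inE => /orP[/eqP ->|/ls//].
  by exists (sigma s) => //; exact: sigmaP.
- have [[so _ _ _] /(_ _ FA)[V sV AV]] := sigmaP s ls.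
  by exists (rcons s V); rewrite last_rcons; split=> //; [exists V|exact: so].
pose x n := last set0 (r n.+1).
have rE n : r n = mkseq x n.
  elim: n => [//|n IH]; rewrite mkseqSr -IH /x.
  by have [V _ <-] := rn n; rewrite last_rcons.
have xP n : sigma (mkseq x n) (x n).
  rewrite -rE /x; have [V sV <-] := rn n.
  by rewrite last_rcons.
have lr n : legal (r n).
  elim: n => [|n IH]; first by rewrite r0.
  have [V sV <-] := rn n => W; rewrite /= mem_rcons inE => /orP[/eqP ->|/IH//].
  by exists (sigma (r n)) => //; exact: sigmaP.
apply: (sigmaQ x xP); apply: covers_of_proper => [_ [n _ <-]|A FA].
  have := xP n; rewrite -rE; exact: (covers_ofW (sigmaP _ (lr n))).
by have [n _ An] := rcov A 0%N FA; exists (x n).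
Qed.

(** Positions are the finite sequences of One's moves in the dual game, and what
    One offers to Two is the answer of the supposed winning strategy. *)
Lemma covering_runs_two_wins : covering_runs F ->
  ~ two_wins (family_nbhds F) (~` Fcovers).
Proof.
move=> runF [tau [tauP tauQ]].
pose legal (s : seq (set (set X))) := [set` s] `<=` family_nbhds F.
have lnext s A : legal s -> F A -> legal (rcons s (set_nbhds A)).
  move=> ls FA B; rewrite /= mem_rcons inE => /orP[/eqP ->|/ls//].
  by exists A.
have [//|s _ ls [A FA <-]|s A ls FA|r [r0 rn rcov]] := runF _ legal
    (fun s => [set rcons s (set_nbhds A) | A in F]) tau [::].
- exact: lnext.
- have [[oV _ _] AV] := tauP s _ ls (ex_intro2 _ _ A FA erefl).
  by exists (rcons s (set_nbhds A)); split=> //; exists A.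
pose B n := last set0 (r n.+1).
have rE n : r n = mkseq B n.
  elim: n => [//|n IH]; rewrite mkseqSr -IH /B.
  by have [A _ <-] := rn n; rewrite last_rcons.
have BP n : family_nbhds F (B n).
  by rewrite /B; have [A FA <-] := rn n; rewrite last_rcons; exists A.
apply: (tauQ B BP); apply: covers_of_proper => [_ [n _ <-]|A FA].
  rewrite mkseqSr; have [A FA BE] := BP n.
  have [] // : set_nbhds A (tau (rcons (mkseq B n) (B n))).
  by rewrite BE; apply: tauP => // _ /= /mapP[k _ ->].
have [n _ An] := rcov A 0%N FA; exists (tau (r n.+1)) => //.
by exists n => //; rewrite rE.
Qed.

(** Two's Markov strategy is to answer round [n] from the [n]-th term of a
    sequence of covers that admits no good selection. *)
Lemma two_markov_wins_covers :
  ~ two_markov_wins (family_nbhds F) (~` Fcovers) -> selection1 Fcovers Fcovers.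
Proof.
move=> nII U UF; apply: contrapT => nU; apply: nII.
have /choice[tau tauP] : forall N, exists tau : nat -> set X, forall n,
    family_nbhds F N -> N (tau n) /\ U n (tau n).
  move=> N.
  suff /choice[f fP] : forall n, exists V, family_nbhds F N -> N V /\ U n V.
    by exists f.
  move=> n.
  have [[A FA <-]|nN] := pselect (family_nbhds F N); last by exists set0 => /nN.
  have [V UV AV] := (UF n).2 _ FA; exists V => _; split=> //; split=> //.
  exact: covers_ofW (UF n) _ UV.
exists tau; split=> [N n /(tauP N n)[]//|B BP cov]; apply: nU.
by exists (fun n => tau (B n) n); split=> // n; have [] := tauP _ n (BP n).
Qed.

End Covers.

(** * Compact sets *)

(** Compactness in the form of an induction: a property of sets that is closed
    under unions and holds locally on [K] holds for a set including [K]. *)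
Lemma compact_directed (T : topologicalType) (K : set T) (D : set (set T)) :
  compact K -> D set0 -> setU_closed D ->
  (forall x, K x -> exists2 V, D V & nbhs x V) -> exists2 V, D V & K `<=` V.
Proof.
move=> /compact_near_coveringP Kcov D0 DU KD.
pose B V : set (set T) := [set W | D W /\ V `<=` W].
have BF : Filter (filter_from D B).
  apply: filter_from_filter; first by exists set0.
  move=> V W DV DW; exists (V `|` W); first exact: DU.
  by move=> S [DS]; rewrite subUset => -[? ?].
have [|V DV VB] := Kcov _ (filter_from D B) (fun W x => W x) BF; last first.
  by exists V => //; apply: (VB V); split.
move=> x /KD[V DV xV]; exists (V, B V); first by split=> //; exists V => // ?.
by move=> [y W] /= [Vy [_]]; apply.
Qed.

Lemma regular_compact_nbhs (T : topologicalType) (K U : set T) :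
  regular_space T -> compact K -> open U -> K `<=` U ->
  exists V, [/\ open V, K `<=` V & closure V `<=` U].
Proof.
move=> regT cK oU KU.
have [|V W [oV VU] [oW WU]|x Kx|V [oV VU] KV] :=
    compact_directed (D := [set V | open V /\ closure V `<=` U]) cK.
- by split; [exact: open0|rewrite closure0; exact: sub0set].
- by split; [exact: openU|rewrite closureU subUset; split].
- have [|B xB BU] := regT x U.
    by apply: open_nbhs_nbhs; split=> //; exact: KU.
  exists (interior B); last exact: nbhs_interior.
  split; first exact: open_interior.
  by apply: subset_trans BU; apply: closure_subset; exact: interior_subset.
- by exists V.
Qed.

(** * Usco maps *)

Section UscoFacts.
Local Open Scope ring_scope.
Context (X : ptopologicalType) (R : realType).
Implicit Types (Phi Psi : X -> set R) (V : set X).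

Lemma usco_nbhs Phi x (W : set R) : usco Phi -> open W -> Phi x `<=` W ->
  \forall x' \near x, Phi x' `<=` W.
Proof.
by move=> [_ _ uPhi] oW xW; apply: open_nbhs_nbhs; split=> //; exact: uPhi.
Qed.

Lemma closed_usco_graph Phi : usco Phi -> closed (usco_graph Phi).
Proof.
move=> uPhi [x y] cl; apply: contrapT => nPhi; have [_ cPhi _] := uPhi.
have [B yB BPhi] : exists2 B, nbhs y B & closure B `<=` ~` Phi x.
  apply: uniform_regular; apply: open_nbhs_nbhs; split=> //.
  by apply: closed_openC; apply: compact_closed (cPhi x); exact: Rhausdorff.
have near_x : \forall x' \near x, Phi x' `<=` ~` closure B.
  apply: usco_nbhs => //; first by apply: closed_openC; exact: closed_closure.
  by move=> z Pz /BPhi.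
have [|[x' y'] [/= Pxy [/= /(_ _ Pxy) nB By]]] :=
    cl ([set x' | Phi x' `<=` ~` closure B] `*` B).
  by exists ([set x' | Phi x' `<=` ~` closure B], B).
by apply: nB; exact: subset_closure.
Qed.

(** The values of [Phi] at [x] outside [W] form a compact set, and [G] has no
    point in some neighborhood of it over a neighborhood of [x].  Empty values
    are allowed on purpose: with [W] empty, the lemma shows that the points
    where the value is empty form an open set, so that values nonempty on a
    dense set are nonempty everywhere. *)
Lemma closed_sub_usco Phi (G : set (X * R)) (W : set R) :
  usco Phi -> closed G -> G `<=` usco_graph Phi -> open W ->
  open [set x | [set y | G (x, y)] `<=` W].
Proof.
move=> uPhi cG GPhi oW; rewrite openE => x GW.
have cK : compact (Phi x `&` ~` W).
  by apply: compact_closedI; [have [] := uPhi|exact: open_closedC].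
pose D := [set O : set R | open O /\
  \forall x' \near x, forall y, O y -> ~ G (x', y)].
have [|O P [oO nO] [oP nP]|y [Phiy nWy]|O [oO nO] KO] :=
    compact_directed (D := D) cK.
- split; first exact: open0.
  by apply: nearW.
- split; first exact: openU.
  by apply: filterS2 nO nP => x' GO GP y [/GO|/GP].
- have : nbhs (x, y) (~` G).
    by apply: open_nbhs_nbhs; split; [exact: closed_openC|move=> /GW].
  move=> [[N O] /= [xN yO] NO]; exists (interior O); last exact: nbhs_interior.
  split; first exact: open_interior.
  by apply: filterS xN => x' Nx' z /interior_subset Oz; apply: NO.
have WO : \forall x' \near x, Phi x' `<=` W `|` O.
  apply: usco_nbhs => //; first exact: openU.
  by move=> y Py; have [Wy|nWy] := pselect (W y); [left|right; apply: KO].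
apply: filterS2 nO WO => x' GO PhiWO y Gy.
by have [//|/GO] := PhiWO y (GPhi _ Gy).
Qed.

Lemma usco_setU1 Phi (c : R) : usco Phi -> usco (fun x => Phi x `|` [set c]).
Proof.
move=> [Phi0 cPhi oPhi]; split=> [x|x|W oW].
- by have [y Py] := Phi0 x; exists y; left.
- by apply: compactU; [exact: cPhi|exact: compact_set1].
- have [Wc|nWc] := pselect (W c).
    rewrite (_ : mkset _ = [set x | Phi x `<=` W]); first exact: oPhi.
    apply/seteqP; split=> x /=; rewrite subUset; first by case.
    by move=> PW; split=> // _ ->.
  rewrite (_ : mkset _ = set0); first exact: open0.
  by apply/seteqP; split=> // x /= /(_ c (or_intror erefl)).
Qed.

(** Off [V] the semicontinuity of [Phi] suffices, since the patched map stays
    below [Phi]. *)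
Lemma usco_patch Phi Psi V : usco Phi -> usco Psi -> open V ->
  (forall x, V x -> Psi x `<=` Phi x) ->
  usco (fun x => if `[< V x >] then Psi x else Phi x).
Proof.
move=> uPhi uPsi oV PsiPhi; have [Phi0 cPhi oPhi] := uPhi.
have [Psi0 cPsi oPsi] := uPsi; split=> [x|x|W oW]; try by case: ifP.
rewrite openE => x /=; case: asboolP => [Vx xW|nVx xW].
  have nearV : \forall x' \near x, V x' by apply: open_nbhs_nbhs.
  apply: filterS2 nearV (usco_nbhs uPsi oW xW) => x' Vx' /=.
  by rewrite asboolT.
apply: filterS (usco_nbhs uPhi oW xW) => x' x'W /=.
by case: asboolP => // Vx' y /(PsiPhi _ Vx')/x'W.
Qed.

(** The value [c] is glued to [Phi] along the boundary of [V] by closing the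
    graph.  The result is minimal because its graph is the closure of its part
    over the dense open set [V `|` ~` closure V], where [Phi] is minimal and
    the constant map too. *)
Lemma minimal_usco_glue (Phi : MU X R) V (c : R) : open V ->
  exists Psi : MU X R, (forall x, V x -> Psi x = Phi x) /\
    (forall x, ~ closure V x -> Psi x = [set c]).
Proof.
move=> oV; have [uPhi minPhi] := MU_minimal Phi.
have [Phi0 cPhi oPhi] := uPhi.
pose E : set (X * R) :=
  [set p | V p.1 /\ Phi p.1 p.2 \/ ~ closure V p.1 /\ p.2 = c].
pose Psi x : set R := [set y | closure E (x, y)].
have EPhi : closure E `<=` usco_graph (fun x => Phi x `|` [set c]).
  have cl := closed_usco_graph (usco_setU1 c uPhi).
  apply: subset_trans cl; apply: closure_subset => -[x y].
  by case=> -[_ ?]; [left|right].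
have PsiV x : V x -> Psi x = Phi x.
  move=> Vx; apply/seteqP; split=> y; last first.
    by move=> Py; apply: subset_closure; left.
  move=> Exy; rewrite -[Phi x y]/(usco_graph Phi (x, y)).
  apply: (closed_usco_graph uPhi) => B xyB.
  have : nbhs (x, y) (B `&` (V `*` setT)).
    apply: filterI => //; exists (V, setT) => //; split=> //=.
      exact: open_nbhs_nbhs.
    exact: filterT.
  move=> /Exy[[x' y'] [E' [B' [/= V' _]]]]; exists (x', y'); split=> //.
  by case: E' => -[] //= nV; case: nV; exact: subset_closure.
have PsiC x : ~ closure V x -> Psi x = [set c].
  move=> nVx; apply/seteqP; split=> y; last first.
    by move=> ->; apply: subset_closure; right.
  move=> Exy; apply: contrapT => /= yc.
  have : nbhs (x, y) (~` closure V `*` ~` [set c]).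
    exists (~` closure V, ~` [set c]) => //=; split.
      apply: open_nbhs_nbhs; split=> //.
      by apply: closed_openC; exact: closed_closure.
    apply: open_nbhs_nbhs; split=> //; apply: closed_openC.
    by apply: compact_closed; [exact: Rhausdorff|exact: compact_set1].
  move=> /Exy[[x' y'] [E' [/= V' c']]].
  by case: E' => -[] //= Vx' _; apply: V'; exact: subset_closure.
have oPsi W : open W -> open [set x | Psi x `<=` W].
  by apply: closed_sub_usco EPhi; [exact: usco_setU1|exact: closed_closure].
have uPsi : usco Psi.
  split=> // x.
    apply: contrapT => nPsi.
    have : nbhs x [set x' | Psi x' `<=` set0].
      apply: open_nbhs_nbhs; split; first by apply: oPsi; exact: open0.
      by move=> y Py; apply: nPsi; exists y.
    have [Vx|nVx] := pselect (closure V x).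
      move=> /Vx[x' [Vx']]; rewrite /= PsiV// => Pset0.
      by have [y /Pset0] := Phi0 x'.
    by move=> _; apply: nPsi; exists c; rewrite PsiC.
  apply: (@subclosed_compact _ _ (Phi x `|` [set c])).
  - move=> y cl; apply: closed_closure => B [[N O] /= [xN yO] NO].
    have [z [Pz Oz]] := cl _ yO; exists (x, z); split=> //; apply: NO.
    by split=> //=; exact: nbhs_singleton.
  - by apply: compactU; [exact: cPhi|exact: compact_set1].
  - by move=> y /EPhi.
suff mPsi : minimal_usco Psi by exists (MkMU mPsi).
split=> // Xi uXi XiPsi; apply/seteqP; split=> //.
apply: subset_trans (closed_usco_graph uXi); apply: closure_subset.
move=> [x y] [[/= Vx Phixy]|[/= nVx ->]]; last first.
  have [Xi0 _ _] := uXi; have [z Tz] := Xi0 x.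
  by have := XiPsi (x, z) Tz; rewrite /usco_graph /= PsiC// => <-.
have XiPhi x' : V x' -> Xi x' `<=` Phi x'.
  by move=> Vx' z Tz; rewrite -PsiV//; exact: (XiPsi (x', z) Tz).
have := minPhi _ (usco_patch uPhi uXi oV XiPhi); rewrite /usco_graph.
have sub : [set p : X * R | (if `[< V p.1 >] then Xi p.1 else Phi p.1) p.2]
    `<=` [set p | Phi p.1 p.2].
  by move=> [x' z] /=; case: asboolP => // Vx' /XiPhi; apply.
move=> /(_ sub)/seteqP[_ /(_ (x, y) Phixy)] /=.
by rewrite asboolT.
Qed.

Lemma MU_bounded (Phi : MU X R) (A : set X) : compact A ->
  exists n : nat, forall x y, A x -> Phi x y -> `|y| < n%:R.
Proof.
move=> cA; have [uPhi _] := MU_minimal Phi; have [_ cPhi _] := uPhi.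
pose D T (f : T -> set R) : set (set T) :=
  [set V | exists n : nat, forall x y, V x -> f x y -> `|y| < n%:R].
have D0 T f : @D T f set0 by exists 0%N.
have DU T f : setU_closed (@D T f).
  move=> V W [n Vn] [m Wm]; exists (maxn n m) => x y [/Vn h|/Wm h] /h yn.
    by apply: lt_le_trans yn _; rewrite ler_nat leq_maxl.
  by apply: lt_le_trans yn _; rewrite ler_nat leq_maxr.
have oball (n : nat) : open [set y : R | `|y| < n%:R].
  rewrite (_ : mkset _ = ball (0 : R) n%:R); first exact: ball_open.
  by apply/seteqP; split=> y; rewrite /= -ball_normE /= sub0r normrN.
have Phi_bounded x : exists n : nat, forall y, Phi x y -> `|y| < n%:R.
  have [|W [n Wn] PhiW] := compact_directed (cPhi x) (D0 _ set1) (DU _ set1).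
    move=> y _; exists [set z : R | `|z| < (Num.bound `|y|)%:R].
      by exists (Num.bound `|y|) => z _ /= + ->.
    apply: open_nbhs_nbhs; split; first exact: oball.
    exact: archi_boundP (normr_ge0 y).
  by exists n => y Py; exact: (Wn y y (PhiW _ Py)).
have [x _|V [n Vn] AV] := compact_directed cA (D0 _ Phi) (DU _ Phi).
  have [n xn] := Phi_bounded x.
  exists [set x' | Phi x' `<=` [set y : R | `|y| < n%:R]].
    by exists n => x' y; apply.
  exact: usco_nbhs.
by exists n => x y Ax; exact: (Vn x y (AV _ Ax)).
Qed.

Lemma MU_ball_triangle (Phi Psi Xi : MU X R) (A : set X) (d e : R) :
  MU_ball Phi A d Psi -> MU_ball Psi A e Xi ->
  MU_ball Phi A (d + e) Xi.
Proof.
move=> h k x Ax; have [h1 h2] := h x Ax; have [k1 k2] := k x Ax; split=> y.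
- move=> /h1[z /k1[w Tw zw] yz]; exists w => //.
  by rewrite -(subrKA z) (le_lt_trans (ler_normD _ _))// ltrD.
- move=> /k2[z /h2[w Tw wz] zy]; exists w => //.
  by rewrite -(subrKA z) (le_lt_trans (ler_normD _ _))// ltrD.
Qed.

Lemma MU_ball_eq (Phi Psi : MU X R) (A : set X) (e : R) : 0 < e ->
  (forall x, A x -> Psi x = Phi x) -> MU_ball Phi A e Psi.
Proof.
move=> e0 PsiE x /PsiE ->.
by split=> y Py; exists y => //; rewrite subrr normr0.
Qed.

Lemma MU_eq (Phi Psi : MU X R) :
  (forall x e, 0 < e -> MU_ball Phi [set x] e Psi) -> Phi = Psi.
Proof.
move=> PhiPsi; suff E : MU_fun Phi = MU_fun Psi.
  case: Phi Psi E {PhiPsi} => f fP [g gP] /= E; subst g.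
  by congr MkMU; exact: Prop_irrelevance.
have cl (Xi : MU X R) x y :
    (forall e : R, 0 < e -> exists2 z, Xi x z & `|y - z| < e) -> Xi x y.
  move=> yT; have [[_ cT _] _] := MU_minimal Xi.
  apply: (compact_closed (@Rhausdorff R) (cT x)) => B /nbhs_ballP[e /= e0 eB].
  have [z Tz yz] := yT e e0; exists z; split=> //; apply: eB.
  by rewrite -ball_normE.
apply/funext => x; apply/seteqP; split=> y Py; apply: cl => e e0.
  by have [/(_ y Py)] := PhiPsi x e e0 x erefl.
have [_ /(_ y Py)[z Pz zy]] := PhiPsi x e e0 x erefl.
by exists z => //; rewrite distrC.
Qed.

(** The sets [MU_ball Phi A e] may fail to be open, but by the triangle
    inequality the maps around which they contain a ball form an open set. *)
Lemma MU_open_nbhs (F : set (set X)) (Phi : MU X R) (O : set (MU X R)) :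
  (exists P, [/\ MU_open F P, P Phi & P `<=` O]) <->
  exists A e, [/\ F A, 0 < e & MU_ball Phi A e `<=` O].
Proof.
split=> [[P [oP PPhi PO]]|[A [e [FA e0 AO]]]].
  have [A [e [FA e0 AP]]] := oP _ PPhi; exists A, e; split=> //.
  exact: subset_trans PO.
exists [set Psi | exists B d, [/\ F B, 0 < d & MU_ball Psi B d `<=` O]].
split=> [Psi [B [d [FB d0 BO]]]||Psi [B [d [_ d0]]]].
- exists B, (d / 2); split=> //; first by rewrite divr_gt0.
  move=> Xi PT; exists B, (d / 2); split=> //; first by rewrite divr_gt0.
  move=> Chi TX; apply: BO; rewrite [d]splitr.
  exact: MU_ball_triangle PT TX.
- by exists A, e.
- by apply; exact: MU_ball_eq.
Qed.

End UscoFacts.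

(** * Games on the spaces of minimal usco maps *)

(** Two's Markov strategy is to answer round [n] from the [n]-th term of a
    sequence of sets that admits no good selection. *)
Lemma point_game_fan_tightness (Z : topologicalType) (z : Z) :
  ~ two_markov_wins (point_nbhds z) (~` clustering_at z) ->
  strong_countable_fan_tightness z.
Proof.
move=> nII S clS; apply: contrapT => nS; apply: nII.
have /choice[tau tauP] : forall O, exists tau : nat -> Z, forall n,
    point_nbhds z O -> O (tau n) /\ S n (tau n).
  move=> O.
  suff /choice[f fP] : forall n, exists w, point_nbhds z O -> O w /\ S n w.
    by exists f.
  move=> n; have [[[oO _ _] Oz]|nO] := pselect (point_nbhds z O); last first.
    by exists z => /nO.
  have [|w [Sw Ow]] := clS n O; first exact: open_nbhs_nbhs.
  by exists w.
exists tau; split=> [N n /(tauP N n)[]//|B BP cl]; apply: nS.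
by exists (fun n => tau (B n) n); split=> // n; have [] := tauP _ n (BP n).
Qed.

Lemma fan_tightness_dense_fan_tightness (Z : topologicalType) (z : Z) :
  strong_countable_fan_tightness z -> strong_countable_dense_fan_tightness z.
Proof.
move=> Sz B dB; apply: Sz => n O /nbhs_interior Oz.
have [|w [wO wB]] := dB n _ (ex_intro _ z (nbhs_singleton Oz)).
  exact: open_interior.
by exists w; split=> //; exact: interior_subset.
Qed.

(** A point [z] has a neighborhood with finitely many terms of the sequence, and
    removing those different from [z] leaves at most [z] itself. *)
Lemma locally_finite_closed_discrete (Z : topologicalType) (f : nat -> Z) :
  accessible_space Z ->
  (forall z : Z, exists N,
    \forall w \near z, forall n, (N <= n)%N -> w <> f n) ->
  closed_discrete Z (range f).
Proof.
move=> T1_Z ff.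
have single (z : Z) : \forall w \near z, forall n, w = f n -> w = z.
  have [N fN] := ff z.
  have small k : \forall w \near z, forall n, (n < k)%N -> w = f n -> w = z.
    elim: k => [|k IH]; first by apply: nearW => w n; rewrite ltn0.
    have [fkz|fkz] := eqVneq (f k) z.
      apply: filterS IH => w IH n; rewrite ltnS leq_eqVlt.
      by move=> /orP[/eqP -> ->//|]; exact: IH.
    have nfk : \forall w \near z, w <> f k.
      apply: open_nbhs_nbhs; split; last by move=> /esym/eqP; exact/negP.
      by apply: closed_openC; exact: accessible_closed_set1.
    apply: filterS2 IH nfk => w IH wk n; rewrite ltnS leq_eqVlt.
    by move=> /orP[/eqP -> /wk//|]; exact: IH.
  apply: filterS2 fN (small N) => w wN wz n wn.
  by have [/wN//|nN] := leqP N n; exact: wz wn.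
split=> [z cl|_ [m _ <-]].
  by have [_ [[n _ <-] /(_ n erefl) <-]] := cl _ (single z); exists n.
split; first by rewrite inE; exists m.
exists [set w | forall n, w = f n -> w = f m]; first exact: single.
apply/seteqP; split=> [w [/= wm [n _ fw]]|_ ->]; first exact: (wm n).
by split=> //; exists m.
Qed.

Section FunctionSpace.
Local Open Scope ring_scope.
Context (X : ptopologicalType) (R : realType).
Context (T1_X : accessible_space X) (regular_X : regular_space X).
Context (F : set (set X)).
Context (F1 : forall x, F [set x]) (FU : setU_closed F).
Context (F0 : forall A, F A -> A !=set0) (FT : ~ F setT).
Context (Fcompact : forall A, F A -> compact A).

(** [Z] stands for the space of minimal usco maps with the topology of uniform
    convergence on the members of [F]; a point [z] is the map [v z]. *)
Context (Z : topologicalType) (v : Z -> MU X R).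
Context (v_inj : injective v) (v_surj : forall Phi, exists z, v z = Phi).
Context (nbhs_v : forall z (O : set Z), nbhs z O <->
  exists A e, [/\ F A, 0 < e & forall w, MU_ball (v z) A e (v w) -> O w]).
Context (z0 : Z) (v0 : v z0 = MU0 X R).

Let Fcovers := covers_of F.

Lemma nbhs_MU_ball z A e : F A -> 0 < e ->
  nbhs z [set w | MU_ball (v z) A e (v w)].
Proof. by move=> FA e0; apply/nbhs_v; exists A, e. Qed.

Lemma accessible_v : accessible_space Z.
Proof.
move=> z w zw; exists (~` [set w]); split; last by rewrite inE /= => /(_ erefl).
  rewrite openE => u /= uw.
  have [x [e [e0 nball]]] : exists x e, 0 < e /\ ~ MU_ball (v u) [set x] e (v w).
    apply: contrapT => h; apply: uw; apply: v_inj; apply: MU_eq => x e e0.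
    by apply: contrapT => nball; apply: h; exists x, e.
  apply: filterS (nbhs_MU_ball u (F1 x) e0) => t /= ball tw.
  by apply: nball; rewrite -tw.
by rewrite inE /=; apply/eqP.
Qed.

(** As [A] is compact and [X] regular, there is an open set between [A] and [U]
    whose closure is still inside [U]; the gluing takes place at its boundary. *)
Lemma v_glue z A U (c : R) : F A -> open U -> A `<=` U ->
  exists w, (forall x, A x -> v w x = v z x) /\
            (forall x, ~ U x -> v w x = [set c]).
Proof.
move=> FA oU AU.
have [V [oV AV VU]] := regular_compact_nbhs regular_X (Fcompact FA) oU AU.
have [Psi [PsiV PsiC]] := minimal_usco_glue (v z) c oV.
have [w vw] := v_surj Psi; exists w; rewrite vw; split=> x.
  by move=> /AV/PsiV.
by move=> nU; apply: PsiC => /VU.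
Qed.

Definition constant_off (U : set (set X)) (c : R) : set Z :=
  [set z | exists2 V, U V & forall x, ~ V x -> v z x = [set c]].

Lemma dense_constant_off U c : Fcovers U -> dense (constant_off U c).
Proof.
move=> [[Uo _ _ _] UF] O [z Oz] oO.
have /nbhs_v[A [e [FA e0 AO]]] : nbhs z O by exact: open_nbhs_nbhs.
have [V UV AV] := UF A FA.
have [w [wA wV]] := v_glue z c FA (Uo _ UV) AV.
exists w; split; last by exists V.
by apply: AO; exact: MU_ball_eq.
Qed.

(** A map near zero on [A] cannot take the value 1 there, so the member of the
    cover off which it is constantly 1 includes [A]. *)
Lemma dense_fan_tightness_covers :
  strong_countable_dense_fan_tightness z0 -> selection1 Fcovers Fcovers.
Proof.
move=> Sz U UF.
have [n|z [zU clz]] := Sz (fun n => constant_off (U n) 1).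
  exact: dense_constant_off.
have /choice[V VP] : forall n, exists V, U n V /\
    forall x, ~ V x -> v (z n) x = [set 1].
  by move=> n; have [V ? ?] := zU n; exists V.
exists V; split=> [n|]; first by have [] := VP n.
apply: covers_of_proper => // [_ [n _ <-]|A FA].
  by apply: covers_ofW (UF n) _ _; have [] := VP n.
have [_ [[n _ <-] /= ball]] := clz _ (nbhs_MU_ball z0 FA (ltr01 : 0 < 1 :> R)).
exists (V n) => [|x Ax]; first by exists n.
apply: contrapT => nV.
have [_] := ball x Ax; rewrite (VP n).2// v0 => /(_ 1 erefl)[_ ->].
by rewrite sub0r normrN normr1 ltxx.
Qed.

(** Against the bad sequence [U] of covers, Two answers round [n] with a map
    equal to [n] off some member of [U n].  Some [A] in [F] is covered by none
    of these members, and as every usco map is bounded on the compact set [A],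
    the answers escape to infinity. *)
Lemma closed_discrete_game_covers :
  ~ two_markov_wins (proper_opens Z) (closed_discrete Z) ->
  selection1 Fcovers Fcovers.
Proof.
move=> nII U UF; apply: contrapT => nU; apply: nII.
have /choice[tau tauP] : forall O, exists tau : nat -> Z, forall n,
    proper_opens Z O -> O (tau n) /\ constant_off (U n) n%:R (tau n).
  move=> O.
  suff /choice[f fP] : forall n, exists w, proper_opens Z O ->
    O w /\ constant_off (U n) n%:R w by exists f.
  move=> n; have [[oO On0 _]|nO] := pselect (proper_opens Z O); last first.
    by exists z0 => /nO.
  by have [w Ow] := dense_constant_off n%:R (UF n) On0 oO; exists w.
exists tau; split=> [N n /(tauP N n)[]//|B BP].
have /choice[V VP] : forall n, exists V, U n V /\
    forall x, ~ V x -> v (tau (B n) n) x = [set n%:R].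
  by move=> n; have [_ [V ? ?]] := tauP _ n (BP n); exists V.
have [A [FA AV]] : exists A, F A /\ forall n, ~ A `<=` V n.
  apply: contrapT => h; apply: nU; exists V.
  split=> [n|]; first by have [] := VP n.
  apply: covers_of_proper => // [_ [n _ <-]|A FA].
    by apply: covers_ofW (UF n) _ _; have [] := VP n.
  apply: contrapT => nA; apply: h; exists A; split=> // n AVn.
  by apply: nA; exists (V n).
apply: locally_finite_closed_discrete; first exact: accessible_v.
move=> z; have [N zN] := MU_bounded (v z) (Fcompact FA).
exists N.+1; apply: filterS (nbhs_MU_ball z FA (ltr01 : 0 < 1 :> R)).
move=> w /= ball n Nn wE.
have [x [Ax nVx]] : exists x, A x /\ ~ V n x.
  apply: contrapT => h; apply: (AV n) => x Ax; apply: contrapT => nVx.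
  by apply: h; exists x.
have [_] := ball x Ax; rewrite wE (VP n).2// => /(_ n%:R erefl)[y zy yn].
have := zN x y Ax zy; apply/negP; rewrite -leNgt.
have : `|n%:R| - `|y| < 1 :> R.
  by apply: le_lt_trans yn; rewrite distrC; exact: lerB_dist.
rewrite normr_nat ltrBlDr => ny.
have : N%:R + 1 <= n%:R :> R by rewrite natr1 ler_nat.
by move=> /le_lt_trans/(_ ny); rewrite addrC ltrD2l => /ltW.
Qed.

(** If One plays smaller and smaller neighborhoods [O A n] of the zero map, the
    sets where Two's answers are small are open and contain the sets [A] that
    One has in mind; a covering run makes Two's answers cluster at zero. *)
Lemma covering_runs_cluster (P : set (set Z)) (tau : seq (set Z) -> Z)
    (O : set X -> nat -> set Z) :
  covering_runs F -> two_strategy P tau -> (forall A n, F A -> P (O A n)) ->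
  (forall A n, F A -> O A n `<=` [set z | MU_ball (v z0) A n.+1%:R^-1 (v z)]) ->
  exists B : nat -> set Z, (forall n, exists2 A, F A & B n = O A n) /\
    closure (range (fun n => tau (mkseq B n.+1))) z0.
Proof.
move=> runF tauP PO Oball.
pose legal (s : seq (set Z)) := [set` s] `<=` P.
pose ans s := [set x | v (tau s) x `<=` ball (0 : R) (size s)%:R^-1].
have lnext s A : legal s -> F A -> legal (rcons s (O A (size s))).
  by move=> ls FA B; rewrite /= mem_rcons inE => /orP[/eqP ->|/ls//]; exact: PO.
have [//|s _ ls [A FA <-]|s A ls FA|r [r0 rn rcov]] := runF _ legal
    (fun s => [set rcons s (O A (size s)) | A in F]) ans [::].
- exact: lnext.
- exists (rcons s (O A (size s))); split; first by exists A.
    have [[_ _ usc] _] := MU_minimal (v (tau (rcons s (O A (size s))))).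
    by apply: usc; exact: ball_open.
  have := Oball A (size s) FA _ (tauP s _ ls (PO A (size s) FA)).
  move=> /= ball x Ax y /(ball x Ax).2[y0]; rewrite v0 => -> .
  by rewrite size_rcons -ball_normE.
pose B n := last set0 (r n.+1).
have rE n : r n = mkseq B n.
  elim: n => [//|n IH]; rewrite mkseqSr -IH /B.
  by have [A _ <-] := rn n; rewrite last_rcons.
exists B; split=> [n|].
  rewrite /B; have [A FA <-] := rn n; exists A => //.
  by rewrite last_rcons rE size_mkseq.
move=> W /nbhs_v[A [e [FA e0 AW]]].
have [n Nn An] := rcov A (Num.bound e^-1) FA.
exists (tau (mkseq B n.+1)); split; first by exists n.
apply: AW => x Ax; rewrite v0.
have small y : v (tau (mkseq B n.+1)) x y -> `|0 - y| < e.
  move=> vy; have := An x Ax; rewrite /ans rE => /(_ y vy).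
  rewrite size_mkseq -ball_normE => /lt_le_trans; apply.
  rewrite invf_ple ?posrE//; apply: ltW.
  apply: lt_le_trans (archi_boundP _) _; first by rewrite invr_ge0 ltW.
  by rewrite ler_nat leqW.
split=> [_ ->|y vy]; last by exists 0 => //; exact: small.
have [[v_neq0 _ _] _] := MU_minimal (v (tau (mkseq B n.+1))).
by have [y vy] := v_neq0 x; exists y => //; exact: small.
Qed.

Let O A n : set Z := interior [set z | MU_ball (v z0) A n.+1%:R^-1 (v z)].

Let OP A n z : F A -> (forall x, A x -> v z x = v z0 x) -> O A n z.
Proof.
move=> FA zA; have n0 : 0 < n.+1%:R^-1 :> R by rewrite invr_gt0.
apply: filterS (nbhs_MU_ball z FA n0) => w /= ball x Ax.
by rewrite -(zA x Ax); exact: ball.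
Qed.

Lemma covering_runs_point_game :
  covering_runs F -> ~ two_wins (point_nbhds z0) (~` clustering_at z0).
Proof.
move=> runF [tau [tauP tauQ]].
have OPz A n : F A -> point_nbhds z0 (O A n).
  move=> FA; have Oz0 : O A n z0 by exact: OP.
  split=> //; split; [exact: open_interior|by exists z0|].
  have [Psi [_ PsiC]] := minimal_usco_glue (v z0) 1 (@open0 X).
  have [w vw] := v_surj Psi; move=> OT; have : O A n w by rewrite OT.
  move=> /interior_subset /= ball; have [x Ax] := F0 FA.
  have [_] := ball x Ax; rewrite v0 vw PsiC ?closure0// => /(_ 1 erefl)[_ ->].
  rewrite sub0r normrN normr1 invf_gt1// => n1.
  by move: n1; rewrite ltNge ler1n.
have [|B [BP cl]] := covering_runs_cluster runF tauP OPz.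
  by move=> A n FA; exact: interior_subset.
by apply: (tauQ B) => // n; have [A FA ->] := BP n; exact: OPz.
Qed.

(** The same moves with the zero map removed: Two's answers cluster at it
    without ever being equal to it. *)
Lemma covering_runs_closed_discrete_game :
  covering_runs F -> ~ two_wins (proper_opens Z) (closed_discrete Z).
Proof.
move=> runF [tau [tauP tauQ]].
have OPz A n : F A -> proper_opens Z (O A n `\ z0).
  move=> FA; split.
  - apply: openI; first exact: open_interior.
    by apply: closed_openC; apply: accessible_closed_set1; exact: accessible_v.
  - have [p nAp] := F_notT FT FA.
    have op : open (~` [set p]).
      by apply: closed_openC; exact: accessible_closed_set1.
    have [|w [wA wp]] := v_glue z0 1 FA op; first by move=> x Ax /= xp; subst x.
    exists w; split; first exact: OP.
    move=> /= wz; have := wp p; rewrite wz v0 => /(_ (fun h => h erefl)).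
    by move=> /seteqP[/(_ 0 erefl)/eqP]; rewrite eq_sym oner_eq0.
  - by move=> OT; have [_ []] : (O A n `\ z0) z0 by rewrite OT.
have [|B [BP cl]] := covering_runs_cluster runF tauP OPz.
  by move=> A n FA z [/interior_subset].
have PB n : proper_opens Z (B n) by have [A FA ->] := BP n; exact: OPz.
have [clo _] := tauQ B PB.
have [n _ zE] := clo _ cl.
have : B n z0.
  by rewrite -zE mkseqSr; apply: tauP => // _ /= /mapP[k _ ->].
by have [A FA ->] := BP n => -[_ []].
Qed.

Theorem covering_games_tfae :
  [<-> selection1 Fcovers Fcovers;
       ~ one_wins Fcovers Fcovers;
       strong_countable_fan_tightness z0;
       strong_countable_dense_fan_tightness z0;
       ~ two_markov_wins (family_nbhds F) (~` Fcovers);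
       ~ two_wins (family_nbhds F) (~` Fcovers);
       ~ two_markov_wins (proper_opens Z) (closed_discrete Z);
       ~ two_wins (proper_opens Z) (closed_discrete Z);
       ~ two_markov_wins (point_nbhds z0) (~` clustering_at z0);
       ~ two_wins (point_nbhds z0) (~` clustering_at z0)].
Proof.
have markov (T : choiceType) (P Q : set (set T)) :
    ~ two_wins P Q -> ~ two_markov_wins P Q.
  by move=> nII /two_markov_wins_two_wins.
have runs : selection1 Fcovers Fcovers -> covering_runs F.
  exact: covers_of_covering_runs.
have point_S1 : ~ two_wins (point_nbhds z0) (~` clustering_at z0) ->
    selection1 Fcovers Fcovers.
  move=> /markov/point_game_fan_tightness/fan_tightness_dense_fan_tightness.
  exact: dense_fan_tightness_covers.
tfae.
- by move=> /runs; exact: covering_runs_one_wins.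
- move=> /one_wins_selection1/runs/covering_runs_point_game/markov.
  exact: point_game_fan_tightness.
- exact: fan_tightness_dense_fan_tightness.
- move=> /dense_fan_tightness_covers/runs runF.
  by apply: markov; exact: covering_runs_two_wins.
- move=> /two_markov_wins_covers/runs.
  exact: covering_runs_two_wins.
- move=> /markov/two_markov_wins_covers/runs.
  by move=> /covering_runs_closed_discrete_game/markov.
- move=> /closed_discrete_game_covers/runs.
  exact: covering_runs_closed_discrete_game.
- move=> /markov/closed_discrete_game_covers/runs.
  by move=> /covering_runs_point_game/markov.
- move=> /point_game_fan_tightness/fan_tightness_dense_fan_tightness.
  move=> /dense_fan_tightness_covers/runs.
  exact: covering_runs_point_game.
- exact: point_S1.
Qed.

End FunctionSpace.

(** * Finite powers and the space of finite subsets *)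

Section FinitePowers.
Context (X : ptopologicalType).

Lemma nbhs_coord (n : nat) (p : {ptws 'I_n -> X}) (i : 'I_n) (U : set X) :
  open U -> U (p i) -> nbhs p [set q : {ptws 'I_n -> X} | U (q i)].
Proof. by move=> oU Up; apply: proj_continuous; exact: open_nbhs_nbhs. Qed.

Lemma nbhs_box (n : nat) (p : {ptws 'I_n.+1 -> X})
    (W : set {ptws 'I_n.+1 -> X}) :
  nbhs p W -> exists U : nat -> set X,
    (forall i : 'I_n.+1, open (U i) /\ U i (p i)) /\
    (forall q : {ptws 'I_n.+1 -> X}, (forall i : 'I_n.+1, U i (q i)) -> W q).
Proof.
pose D := [set U : nat -> set X | forall i : 'I_n.+1, open (U i) /\ U i (p i)].
pose B (U : nat -> set X) :=
  [set q : {ptws 'I_n.+1 -> X} | forall i : 'I_n.+1, U i (q i)].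
have BF : Filter (filter_from D B).
  apply: filter_from_filter.
    by exists (fun=> setT) => i; split=> //; exact: openT.
  move=> U V DU DV; exists (fun k => U k `&` V k).
    move=> i; have [oU Up] := DU i; have [oV Vp] := DV i.
    by split=> //; exact: openI.
  by move=> q UVq; split=> i; have [] := UVq i.
suff cvgp : filter_from D B --> p by move=> /cvgp[U DU BU]; exists U.
apply/cvg_sup => i A [_ [[G oG <-] /= Op] GA].
exists (fun k : nat => if k == i :> nat then G else setT).
  move=> k; case: eqP => [/val_inj ->|_] //; split=> //; exact: openT.
by move=> q /(_ i); rewrite eqxx => Gq; exact: GA.
Qed.

(** Each round serves the powers up to the number of that round: as a finite
    set [A] has finitely many tuples of bounded length, finitely many of the
    given covers suffice to catch all the tuples from some neighborhood [U] of
    [A]. *)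
Lemma covering_runs_powers :
  covering_runs (fin_sets X) -> Rothberger (finite_powers X).
Proof.
move=> runF C Ccov; pose Z := finite_powers X.
have covC n (z : Z) : exists2 G, C n G & G z.
  have [_ CT _ _] := Ccov n; have : setT z by [].
  by rewrite -CT => -[G CG Gz]; exists G.
have block (a : nat) (zs : seq Z) : exists l : seq (set Z),
    (forall i, (i < size l)%N -> C (a + i)%N (nth set0 l i)) /\
    (forall z, z \in zs -> exists2 i, (i < size l)%N & nth set0 l i z).
  elim: zs a => [|z zs IH] a; first by exists [::].
  have [G CG Gz] := covC a z; have [l [lC lcov]] := IH a.+1.
  exists (G :: l); split=> [[|i]|y]; rewrite /= ?addn0//.
    by rewrite ltnS addnS -addSn; exact: lC.
  rewrite inE => /orP[/eqP ->|/lcov[i il Gy]]; first by exists 0%N.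
  by exists i.+1.
pose S := (nat * seq (set Z) * set X)%type.
pose legal (s : S) :=
  forall i, (i < size s.1.2)%N -> C i (nth set0 s.1.2 i).
pose next (s : S) : set S := [set s' | [/\ s'.1.1 = s.1.1.+1,
  exists2 l, s'.1.2 = s.1.2 ++ l &
    forall j (q : {ptws 'I_j.+1 -> X}), (j <= s.1.1)%N ->
      (forall i, s'.2 (q i)) ->
      exists2 i, (i < size l)%N & nth set0 l i (existT _ j q : Z) &
  legal s']].
have [//|s s' _ []//|[[k l] U0] A ls [/finite_seqP[a ->] _]|r [r0 rn rcov]] :=
    runF S legal next snd (0%N, [::], set0).
  pose e := tnth (in_tuple a).
  pose T := {j : 'I_k.+1 & {ffun 'I_j.+1 -> 'I_(size a)}}.
  pose pt (t : T) : Z := existT _ (tag t : nat) (fun i => e (tagged t i)).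
  have [l' [l'C l'cov]] := block (size l) [seq pt t | t <- enum {: T}].
  have /choice[V VP] : forall t : T, exists V : nat -> set X,
      (forall i : 'I_(tag t).+1, open (V i) /\ V i (e (tagged t i))) /\
      forall q : {ptws 'I_(tag t).+1 -> X},
        (forall i : 'I_(tag t).+1, V i (q i)) ->
        exists2 i, (i < size l')%N &
          nth set0 l' i (existT _ (tag t : nat) q : Z).
    move=> t; have [|i il Gz] := l'cov (pt t); first by rewrite map_f ?mem_enum.
    have [oC _ _ _] := Ccov (size l + i)%N.
    have /sigT_openP/(_ (tag t)) := oC _ (l'C i il).
    rewrite openE => /(_ _ Gz)/nbhs_box[V [Vp VG]].
    by exists V; split=> // q /VG; exists i.
  pose U := [set x | exists b : 'I_(size a), forall t, t \in enum {: T} ->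
    forall i, i \in enum 'I_(tag t).+1 -> tagged t i = b -> V t i x].
  exists (k.+1, l ++ l', U); split=> /=.
  - split=> //=; first exists l' => // j q jk Uq.
      have /choice[b bP] := Uq.
      pose t : T := Tagged (fun j : 'I_k.+1 => {ffun 'I_j.+1 -> 'I_(size a)})
        (i := Ordinal (jk : (j < k.+1)%N)) [ffun i => b i].
      have [_ /(_ q)] := VP t; apply => i.
      by apply: bP => /=; rewrite ?mem_enum ?ffunE.
    move=> i /=; rewrite size_cat nth_cat.
    case: (ltnP i (size l)) => [il _|il il'].
      exact: (ls i il).
    by rewrite -{1}(subnKC il); apply: l'C; rewrite ltn_subLR.
  - rewrite (_ : U = \bigcup_b [set x | forall t, t \in enum {: T} ->
        forall i, i \in enum 'I_(tag t).+1 -> tagged t i = b -> V t i x]).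
      apply: bigcup_open => b _.
      apply: open_all_seq => t; apply: open_all_seq => i.
      have [tib|tib] := pselect (tagged t i = b).
        rewrite (_ : (fun _ => _) = V t i); first by have [/(_ i)[]] := VP t.
        by apply/seteqP; split=> x // h; exact: h.
      rewrite (_ : (fun _ => _) = setT); first exact: openT.
      by apply/seteqP; split.
    by apply/seteqP; split=> x [b]; exists b.
  - move=> x /= xa; have xs : (index x a < size a)%N by rewrite index_mem.
    exists (Ordinal xs) => t _ i _ tiE.
    have [/(_ i)[_]] := VP t; rewrite tiE /e (tnth_nth x) /=.
    by rewrite nth_index.
have lr n : legal (r n) by case: n => [|n]; [rewrite r0|have [] := rn n].
have kr n : (r n).1.1 = n.
  by elim: n => [|n IH]; [rewrite r0|have [-> _ _] := rn n; rewrite IH].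
have prefix m n i : (m <= n)%N -> (i < size (r m).1.2)%N ->
    (i < size (r n).1.2)%N /\ nth set0 (r n).1.2 i = nth set0 (r m).1.2 i.
  move=> /subnKC <-; elim: (n - m)%N => [|d IH] im; first by rewrite addn0.
  have [id <-] := IH im; have [_ [l lE _] _] := rn (m + d)%N.
  by rewrite addnS lE size_cat nth_cat id ltn_addr.
have /choice[G GP] : forall i, exists G, C i G /\
    forall n, (i < size (r n).1.2)%N -> G = nth set0 (r n).1.2 i.
  move=> i; have [[n il]|none] := pselect (exists n, (i < size (r n).1.2)%N).
    exists (nth set0 (r n).1.2 i); split=> [|m im]; first exact: lr.
    have [mn|/ltnW nm] := leqP m n; first by have [] := prefix m n i mn im.
    by have [_ ->] := prefix n m i nm il.
  have [G CG _] := covC i (existT _ 0%N (fun=> point) : Z).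
  by exists G; split=> // n il; case: none; exists n.
exists G; split=> [i|]; first by have [] := GP i.
split.
- by move=> _ [i _ <-]; have [oC _ _ _] := Ccov i; apply: oC; have [] := GP i.
- apply/seteqP; split=> // -[j q] _.
  have fin_q : fin_sets X (range q).
    by split; [exact: finite_image|exists (q ord0); exists ord0].
  have [n jn qU] := rcov _ j fin_q; have [_ [l lE lcov] _] := rn n.
  have [||i il Gz] := lcov j q; first by rewrite kr.
    by move=> i; apply: qU; exists i.
  exists (G (size (r n).1.2 + i)%N); first by exists (size (r n).1.2 + i)%N.
  have := (GP (size (r n).1.2 + i)%N).2 n.+1.
  rewrite lE size_cat ltn_add2l => /(_ il) ->.
  by rewrite nth_cat ltnNge leq_addr addKn.
- move=> [i _ G0]; have [_ _ C0 _] := Ccov i; apply: C0; rewrite -G0.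
  by have [] := GP i.
- move=> [i _ GT]; have [_ _ _ CT] := Ccov i; apply: CT; rewrite -GT.
  by have [] := GP i.
Qed.

Lemma Rothberger_image (Z Y : topologicalType) (f : Z -> Y) :
  continuous f -> (forall y, exists z, f z = y) -> Rothberger Z -> Rothberger Y.
Proof.
move=> cf sf RZ C Ccov.
have [n|G [CG [_ covG _ _]]] := RZ (fun n => [set f @^-1` V | V in C n]).
  have [oC CT C0 CX] := Ccov n; split.
  - by move=> _ [V CV <-]; apply: open_comp => [? _|]; [exact: cf|exact: oC].
  - apply/seteqP; split=> // z _; have : setT (f z) by [].
    by rewrite -CT => -[V CV Vz]; exists (f @^-1` V) => //; exists V.
  - move=> [V CV V0]; apply: C0; rewrite (_ : set0 = V)//.
    apply/seteqP; split=> // y Vy.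
    by have [z fz] := sf y; have : (f @^-1` V) z; [rewrite /= fz|rewrite V0].
  - move=> [V CV VT]; apply: CX; rewrite (_ : setT = V)//.
    apply/seteqP; split=> // y _.
    by have [z <-] := sf y; have : setT z; [|rewrite -VT].
have /choice[V VP] : forall n, exists V, C n V /\ f @^-1` V = G n.
  by move=> n; have [V ? ?] := CG n; exists V.
exists V; split=> [n|]; first by have [] := VP n.
have VC n : C n (V n) by have [] := VP n.
split.
- by move=> _ [n _ <-]; have [oC _ _ _] := Ccov n; exact: oC.
- apply/seteqP; split=> // y _; have [z <-] := sf y; have : setT z by [].
  rewrite -covG => -[_ [n _ <-]]; rewrite -(VP n).2.
  by exists (V n) => //; exists n.
- by move=> [n _ V0]; have [_ _ C0 _] := Ccov n; apply: C0; rewrite -V0.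
- by move=> [n _ VT]; have [_ _ _ CT] := Ccov n; apply: CT; rewrite -VT.
Qed.

Lemma continuous_vietoris (Z : topologicalType) (f : Z -> hyperspace X) :
  (forall z U, open U -> set_val (f z) `<=` U ->
    \forall w \near z, set_val (f w) `<=` U) ->
  (forall z U, open U -> set_val (f z) `&` U !=set0 ->
    \forall w \near z, set_val (f w) `&` U !=set0) ->
  continuous f.
Proof.
move=> f_sub f_meet z W [_ [[B sB <-] [C BC Cz] BW]].
apply: filterS BW _; apply: (@filterS _ _ _ (f @^-1` C)).
  by move=> w Cw; exists C.
have [D sD DC] := sB _ BC.
rewrite -DC preimage_bigcap; apply: filter_bigI => E DE.
have := sD _ DE; rewrite inE => -[U oU EU].
have : E (f z) by move: Cz; rewrite -DC; exact.
by case: EU => ->; [exact: f_sub|exact: f_meet].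
Qed.

(** A finite subset is the range of a tuple, and the range depends continuously
    on the tuple. *)
Lemma powers_Pfin : Rothberger (finite_powers X) -> Rothberger (Pfin X).
Proof.
have range_fin (z : finite_powers X) : fin_sets X (range (projT2 z)).
  by split; [exact: finite_image|exists (projT2 z ord0); exists ord0].
have range_compact (z : finite_powers X) : compact_sets X (range (projT2 z)).
  by have [fz z0] := range_fin z; split=> //; exact: finite_compact.
pose g (z : finite_powers X) : hyperspace X :=
  SigSub (mem_set (range_compact z)).
have g_fin z : [set K : hyperspace X | finite_set (set_val K)] (g z).
  by have [] := range_fin z.
pose f z : Pfin X := SigSub (mem_set (g_fin z)).
apply: (@Rothberger_image _ _ f); last first.
  move=> K; have [fK [x Kx]] : fin_sets X (set_val (set_val K)).
    by have [_ K0] := set_valP (set_val K); split=> //; exact: (set_valP K).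
  have [s sE] := (finite_seqP _).1 fK.
  have s_gt0 : (0 < size s)%N by move: Kx; rewrite sE; case: (s).
  exists (existT _ (size s).-1 (fun i : 'I_(size s).-1.+1 => nth x s i)
    : finite_powers X).
  apply/val_inj/val_inj; rewrite -[RHS]/(set_val (set_val K)) sE.
  apply/seteqP; split=> [_ [i _ <-] /=|y /= ys].
    by rewrite mem_nth// (leq_trans (ltn_ord i)) ?prednK.
  have ysize : (index y s < (size s).-1.+1)%N by rewrite prednK// index_mem.
  by exists (Ordinal ysize) => //=; rewrite nth_index.
apply: continuous_comp_initial; apply: continuous_vietoris => -[j q] U oU.
- rewrite [set_val _]/(range q) => qU.
  have : nbhs q [set q' : {ptws 'I_j.+1 -> X} | forall i, U (q' i)].
    pose near_i i := [set q' : {ptws 'I_j.+1 -> X} | U (q' i)].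
    apply: (filter_forall (f := near_i) (nbhs_filter q)) => i.
    by apply: nbhs_coord => //; apply: qU; exact: imageT.
  by apply: filterS => q' /= Uq' _ [i _ <-].
- rewrite [set_val _]/(range q) => -[_ [[i _ <-] Ui]].
  have : nbhs q [set q' : {ptws 'I_j.+1 -> X} | U (q' i)] by exact: nbhs_coord.
  by apply: filterS => q' /= Uq'; exists (q' i); split=> //; exists i.
Qed.

(** The finite subsets of a member of an omega-cover form an open set, and these
    open sets cover the space of finite subsets. *)
Lemma Pfin_omega : Rothberger (Pfin X) -> omega_Rothberger X.
Proof.
move=> RX U UF.
pose up (V : set X) : set (Pfin X) := [set K | set_val (set_val K) `<=` V].
have finP A : fin_sets X A -> exists K : Pfin X, set_val (set_val K) = A.
  move=> [fA A0]; have cA : compact_sets X A.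
    by split=> //; exact: finite_compact.
  have fK : [set K : hyperspace X | finite_set (set_val K)]
      (SigSub (mem_set cA)).
    by [].
  by exists (SigSub (mem_set fK)).
have fin1 x : fin_sets X [set x] by split; [exact: finite_set1|exists x].
have point_up V x K : set_val (set_val K) = [set x] -> up V K = V x.
  move=> KE; rewrite /up /= KE; apply/propext.
  by split=> [/(_ x erefl)//|Vx _ -> //].
have [n|G [UG [_ covG _ _]]] := RX (fun n => [set up V | V in U n]).
  have [[oU UT U0 UX] Ufin] := UF n; split.
  - move=> _ [V UV <-]; exists [set K : hyperspace X | set_val K `<=` V] => //.
    exists [set [set K : hyperspace X | set_val K `<=` V]]; last first.
      by rewrite bigcup_set1.
    move=> _ ->; apply: (@finI_from1 _ _ _ id); exists V; first exact: oU.
    by left.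
  - apply/seteqP; split=> // K _.
    have [|V UV KV] := Ufin (set_val (set_val K)).
      by have [_ K0] := set_valP (set_val K); split=> //; exact: (set_valP K).
    by exists (up V) => //; exists V.
  - move=> [V UV V0]; apply: U0; rewrite (_ : set0 = V)//.
    apply/seteqP; split=> // x Vx; have [K KE] := finP _ (fin1 x).
    by have : up V K; [rewrite (point_up V x K KE)|rewrite V0].
  - move=> [V UV VT]; apply: UX; rewrite (_ : setT = V)//.
    apply/seteqP; split=> // x _; have [K KE] := finP _ (fin1 x).
    by rewrite -(point_up V x K KE) VT.
have /choice[V VP] : forall n, exists V, U n V /\ up V = G n.
  by move=> n; have [V ? ?] := UG n; exists V.
exists V; split=> [n|]; first by have [] := VP n.
apply: covers_of_proper => // [_ [n _ <-]|A /finP[K <-]].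
  by apply: covers_ofW (UF n) _ _; have [] := VP n.
have : setT K by [].
rewrite -covG => -[_ [n _ <-]]; rewrite -(VP n).2 => KV.
by exists (V n) => //; exists n.
Qed.

End FinitePowers.

(** * The equivalences *)

Section Instances.
Local Open Scope ring_scope.
Context (X : ptopologicalType) (R : realType).

Lemma nbhs_MUp (Phi : MUp X R) (O : set (MUp X R)) : nbhs Phi O <->
  exists A (e : R), [/\ fin_sets X A, 0 < e &
    forall Psi : MUp X R, MU_ball Phi A e Psi -> O Psi].
Proof. exact: MU_open_nbhs. Qed.

Lemma nbhs_MUk (Phi : MUk X R) (O : set (MUk X R)) : nbhs Phi O <->
  exists A (e : R), [/\ compact_sets X A, 0 < e &
    forall Psi : MUk X R, MU_ball Phi A e Psi -> O Psi].
Proof. exact: MU_open_nbhs. Qed.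

End Instances.

Theorem corollary51 (R : realType) (X : ptopologicalType)
    (T1_X : accessible_space X) (regular_X : regular_space X) :
  (infinite_set [set: X] ->
   [<-> omega_Rothberger X;
        Rothberger (finite_powers X);
        Rothberger (Pfin X);
        ~ one_wins (omega_covers X) (omega_covers X);
        strong_countable_fan_tightness (MUp0 X R);
        strong_countable_dense_fan_tightness (MUp0 X R);
        ~ two_markov_wins (family_nbhds (fin_sets X)) (~` omega_covers X);
        ~ two_wins (family_nbhds (fin_sets X)) (~` omega_covers X);
        ~ two_markov_wins (proper_opens (MUp X R)) (closed_discrete (MUp X R));
        ~ two_wins (proper_opens (MUp X R)) (closed_discrete (MUp X R));
        ~ two_markov_wins (point_nbhds (MUp0 X R))
            (~` clustering_at (MUp0 X R));
        ~ two_wins (point_nbhds (MUp0 X R))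
            (~` clustering_at (MUp0 X R))]) /\
  (~ compact [set: X] ->
   [<-> k_Rothberger X;
        ~ one_wins (k_covers X) (k_covers X);
        strong_countable_fan_tightness (MUk0 X R);
        strong_countable_dense_fan_tightness (MUk0 X R);
        ~ two_markov_wins (family_nbhds (compact_sets X)) (~` k_covers X);
        ~ two_wins (family_nbhds (compact_sets X)) (~` k_covers X);
        ~ two_markov_wins (proper_opens (MUk X R)) (closed_discrete (MUk X R));
        ~ two_wins (proper_opens (MUk X R)) (closed_discrete (MUk X R));
        ~ two_markov_wins (point_nbhds (MUk0 X R))
            (~` clustering_at (MUk0 X R));
        ~ two_wins (point_nbhds (MUk0 X R))
            (~` clustering_at (MUk0 X R))]).
Proof.
split=> [infX|ncX]; last first.
  apply: (@covering_games_tfae X R T1_X regular_X (compact_sets X) _ _ _ _ _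
    (MUk X R) id) => //.
  - by move=> x; split; [exact: compact_set1|exists x].
  - exact: compact_setsU.
  - by move=> A [].
  - by move=> [].
  - by move=> A [].
  - by move=> Phi; exists Phi.
  - exact: nbhs_MUk.
have F1 x : fin_sets X [set x] by split; [exact: finite_set1|exists x].
have FT : ~ fin_sets X setT by case.
have T : [<-> _; _; _; _; _; _; _; _; _; _] :=
  @covering_games_tfae X R T1_X regular_X (fin_sets X) F1 (@fin_setsU X)
    (fun A FA => FA.2) FT (fun A FA => finite_compact FA.1)
    (MUp X R) id (@inj_id _) (fun Phi => ex_intro _ Phi erefl) (@nbhs_MUp X R)
    (MUp0 X R) erefl.
have powers : omega_Rothberger X -> Rothberger (finite_powers X).
  move=> /(covers_of_covering_runs T1_X F1 (@fin_setsU X) (fun A FA => FA.2) FT).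
  exact: covering_runs_powers.
tfae.
- exact: powers.
- exact: powers_Pfin.
- by move=> /Pfin_omega/(T 0%N 1%N).
- by move=> /(T 1%N 2).
- by move=> /(T 2 3).
- by move=> /(T 3 4).
- by move=> /(T 4 5).
- by move=> /(T 5 6).
- by move=> /(T 6 7).
- by move=> /(T 7 8).
- by move=> /(T 8 9).
- by move=> /(T 9 0%N).
Qed.
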